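(* Let $\mathcal{R}=\langle R; +, <, \dots\rangle$ be a definably complete expansion of a divisible ordered Abelian group of burden $2$, and let $D\subseteq R$ be a definable infinite discrete set. Then there is a definable pseudo-arithmetic set $E\subseteq R$ such that $D$ is definable in $\langle R; +, <, E\rangle$.
   Context: ''Definable'' means with parameters; ''discrete'' refers to the order topology. Definably complete: every nonempty definable subset bounded above has a least upper bound. Burden: supremum of depths of inp-patterns in one variable. For a discrete $E$ and non-maximal $a\in E$, $S_E(a)=\min\{b\in E:b>a\}$ and $E'=\{S_E(a)-a: a\in E\text{ not maximal}\}$; $E$ is pseudo-arithmetic if $|E'|=1$. *)

(* Defs.v *)
From HB Require Import structures.
From mathcomp Require Import all_boot all_order all_algebra.
From mathcomp Require Import mathcomp_extra boolp classical_sets functions cardinality.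

Set Implicit Arguments.
Unset Strict Implicit.
Unset Printing Implicit Defensive.

Import Order.TTheory GRing.Theory.
Local Open Scope classical_set_scope.
Local Open Scope card_scope.
Local Open Scope ring_scope.

(** * First-order logic *)

Record language := Language {
  fsym : Type;
  farity : fsym -> nat;
  rsym : Type;
  rarity : rsym -> nat }.

Record structure (L : language) := Structure {
  carrier :> Type;
  fint : forall f : fsym L, ('I_(farity f) -> carrier) -> carrier;
  rint : forall r : rsym L, ('I_(rarity r) -> carrier) -> Prop }.

Inductive term (L : language) :=
| Var of nat
| App (f : fsym L) of ('I_(farity f) -> term L).

(** Variables are de Bruijn indices: [All] binds index 0.  The connectives
    below generate all of classical first-order logic, as satisfaction is
    valued in the classical [Prop]. *)
Inductive formula (L : language) :=
| Bot
| Eq of term L & term L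
| Rel (r : rsym L) of ('I_(rarity r) -> term L)
| Imp of formula L & formula L
| All of formula L.

Definition scons (T : Type) (a : T) (e : nat -> T) (i : nat) : T :=
  if i is j.+1 then e j else a.

Fixpoint eval (L : language) (M : structure L) (e : nat -> M) (t : term L) : M :=
  match t with
  | Var i => e i
  | App f ts => fint (fun k => eval e (ts k))
  end.

Fixpoint sat (L : language) (M : structure L) (e : nat -> M) (p : formula L) : Prop :=
  match p with
  | Bot => False
  | Eq t u => eval e t = eval e u
  | Rel r ts => rint (fun k => eval e (ts k))
  | Imp p q => sat e p -> sat e q
  | All p => forall a : M, sat (scons a e) p
  end.

(** Index 0 is the free variable [x]; the other indices are parameters, read
    off [b].  Only finitely many of them occur in [p], so an infinite sequence
    [b] carries the same information as a finite parameter tuple. *)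
Definition definable (L : language) (M : structure L) (A : set M) : Prop :=
  exists (p : formula L) (b : nat -> M), A = [set x | sat (scons x b) p].

Definition elementary (L : language) (M N : structure L) (h : M -> N) : Prop :=
  forall (p : formula L) (e : nat -> M), sat e p <-> sat (h \o e) p.

(** * Burden *)

(** A pair [(p, b)] stands for the formula [p(x; b)] over [M] in the single
    variable [x] (index 0). *)
Definition consistent (L : language) (M : structure L)
    (G : set (formula L * (nat -> M))) : Prop :=
  exists (N : structure L) (h : M -> N), elementary h /\
    exists x : N, forall q, G q -> sat (scons x (h \o q.2)) q.1.

(** An inp-pattern in one variable, with set of rows [J], for the theory of
    [M]: its parameters live in some elementary extension [N] of [M]. *)
Definition has_inp_pattern (L : language) (M : structure L) (J : Type) : Prop :=
  exists (N : structure L) (h : M -> N), elementary h /\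
  exists (p : J -> formula L) (b : J -> nat -> nat -> N) (k : J -> nat),
    (forall (i : J) (s : 'I_(k i) -> nat), injective s ->
       ~ consistent [set (p i, b i (s l)) | l in [set: 'I_(k i)]]) /\
    (forall f : J -> nat,
       consistent [set (p i, b i (f i)) | i in [set: J]]).

Definition burden_le (L : language) (M : structure L) (n : nat) : Prop :=
  forall J : Type, has_inp_pattern M J -> [set: J] #<= `I_n.

(** [n] is the least upper bound of the depths of the inp-patterns. *)
Definition burden_eq (L : language) (M : structure L) (n : nat) : Prop :=
  burden_le M n /\ forall m : nat, burden_le M m -> (n <= m)%N.

(** * Expansions of ordered Abelian groups *)

Record divisible_oag (R : porderZmodType) : Prop := DivisibleOag {
  oag_total : forall x y : R, (x <= y) || (y <= x);
  oag_lerD2r : forall x y z : R, x <= y -> x + z <= y + z;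
  oag_divisible : forall (n : nat) (x : R), (0 < n)%N -> exists y : R, y *+ n = x }.

(** The symbols of [L] together with a binary function symbol [+] and a binary
    relation symbol [<], both coded by [None]. *)
Definition og_language (L : language) : language :=
  @Language (option (fsym L)) (fun f => if f is Some g then farity g else 2)
            (option (rsym L)) (fun r => if r is Some s then rarity s else 2).

(** The interpretation in [R] of the symbols of [L]. *)
Record interpretation (L : language) (R : Type) := Interpretation {
  ifun : forall f : fsym L, ('I_(farity f) -> R) -> R;
  irel : forall r : rsym L, ('I_(rarity r) -> R) -> Prop }.

(** The expansion of [(R; +, <)] by the interpretation [I]. *)
Definition og_expansion (R : porderZmodType) (L : language)
    (I : interpretation L R) : structure (og_language L) :=
  @Structure (og_language L) R
    (fun f => match f return ('I_(@farity (og_language L) f) -> R) -> R with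
              | Some g => @ifun L R I g
              | None => fun a => a ord0 + a ord_max
              end)
    (fun r => match r return ('I_(@rarity (og_language L) r) -> R) -> Prop with
              | Some s => @irel L R I s
              | None => fun a => a ord0 < a ord_max
              end).

Definition unary_language : language :=
  @Language void (fun=> 0%N) unit (fun=> 1%N).

Definition unary_interpretation (R : Type) (E : set R) :
    interpretation unary_language R :=
  @Interpretation unary_language R (fun f => match f with end)
    (fun _ a => E (a ord0)).

Definition definably_complete (R : porderZmodType) (L : language)
    (I : interpretation L R) : Prop :=
  forall A : set R, @definable _ (og_expansion I) A ->
    A !=set0 -> has_ubound A -> supremums A !=set0.

(** * Discrete sets *)

(** Every point is isolated in the order topology.  Bounded open intervals are
    enough, since a nontrivial ordered group has no endpoints. *)
Definition discrete_subset (R : porderZmodType) (A : set R) : Prop :=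
  forall a : R, A a -> exists u v : R,
    [/\ u < a, a < v & forall x : R, A x -> u < x -> x < v -> x = a].

Definition nonmaximal (R : porderZmodType) (E : set R) (a : R) : Prop :=
  E a /\ exists2 b : R, E b & a < b.

(** [succ_in E a b] means [b = S_E(a)], the minimum of the elements of [E]
    greater than [a]. *)
Definition succ_in (R : porderZmodType) (E : set R) (a b : R) : Prop :=
  [/\ E b, a < b & forall c : R, E c -> a < c -> b <= c].

(** The set [E']. *)
Definition differences (R : porderZmodType) (E : set R) : set R :=
  [set d | exists a b : R, [/\ nonmaximal E a, succ_in E a b & d = b - a]].

(** The second clause says that [S_E] is defined at every nonmaximal point,
    which discreteness alone does not guarantee. *)
Definition pseudo_arithmetic (R : porderZmodType) (E : set R) : Prop :=
  [/\ discrete_subset E,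
      forall a : R, nonmaximal E a -> exists b : R, succ_in E a b
    & exists d : R, differences E = [set d]].

(* Main.v *)
(** Burden at most 2 excludes three independent families of disjoint uniformly
    definable sets. Two such families come for free from a definable discrete
    set [D]: intervals cutting [D], and the translates of [D] by tiny intervals.

    If a second discrete set fits inside the gaps of [D], it gives a third
    family; hence definable discrete sets have no accumulation points and only
    finitely many gaps. Read [D] as a word over the finite alphabet of its gaps.
    If words of some length are visible in many disjoint intervals, then the
    occurrences of each word give a third family; so some number [N] of distinct
    words cannot all be visible in [N] disjoint intervals. Cutting [D] greedily
    into minimal pieces with more than [N] words of length [N], only finitely many
    pieces arise, and by the Morse-Hedlund argument the next gap on each piece is
    determined by a word of bounded length. The occurrences of a fixed word on a
    piece then have a single gap, so [D] is a finite union of arithmetic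
    progressions, possibly of nonstandard length. The gaps of two infinite
    progressions are commensurable, since otherwise their union would have
    infinitely many gaps; so the longest progression defines all the others, and
    is the required [E]. *)

Require Import Defs.
From mathcomp Require Import all_boot all_order all_algebra.
From mathcomp Require Import boolp classical_sets functions cardinality.
From mathcomp Require Import filter.

Set Implicit Arguments.
Unset Strict Implicit.
Unset Printing Implicit Defensive.

Import Order.TTheory GRing.Theory.
Local Open Scope classical_set_scope.
Local Open Scope ring_scope.

(** * Definable relations *)

Section Renaming.
Variable L : language.
Implicit Types (M : structure L).

Fixpoint term_ren (r : nat -> nat) (t : term L) : term L :=
  match t with
  | Var i => Var L (r i)
  | App f ts => App (fun k => term_ren r (ts k))
  end.

Definition ren_up (r : nat -> nat) (i : nat) : nat :=
  if i is j.+1 then (r j).+1 else 0%N.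

Fixpoint formula_ren (r : nat -> nat) (p : formula L) : formula L :=
  match p with
  | Bot => Bot L
  | Eq t u => Eq (term_ren r t) (term_ren r u)
  | Rel s ts => Rel (fun k => term_ren r (ts k))
  | Imp p q => Imp (formula_ren r p) (formula_ren r q)
  | All p => All (formula_ren (ren_up r) p)
  end.

Lemma eval_ren M (e : nat -> M) r t : eval e (term_ren r t) = eval (e \o r) t.
Proof.
elim: t => [//|f ts IH] /=; congr fint.
by apply: funext => k; exact: IH.
Qed.

Lemma scons_up M (a : M) (e : nat -> M) r :
  scons a e \o ren_up r = scons a (e \o r).
Proof. by apply: funext => -[]. Qed.

Lemma sat_ren M p r (e : nat -> M) : sat e (formula_ren r p) = sat (e \o r) p.
Proof.
elim: p r e => [//|t u|s ts|p IHp q IHq|p IHp] r e /=.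
- by rewrite !eval_ren.
- by congr rint; apply: funext => k; rewrite eval_ren.
- by rewrite IHp IHq.
- by apply: eq_forall => a; rewrite IHp scons_up.
Qed.

(** A relation on environments is definable when it is defined by a formula
    each of whose variables is read off the environment ([inl j]) or is a
    parameter ([inr m]). *)
Definition read M (s : nat -> nat + M) (e : nat -> M) (i : nat) : M :=
  match s i with inl j => e j | inr m => m end.

Definition defrel M (P : (nat -> M) -> Prop) : Prop :=
  exists (p : formula L) (s : nat -> nat + M), forall e, P e <-> sat (read s e) p.

Lemma defrel_ext M (P Q : (nat -> M) -> Prop) :
  (forall e, P e <-> Q e) -> defrel P -> defrel Q.
Proof. by move=> PQ [p [s ps]]; exists p, s => e; rewrite -PQ. Qed.

Lemma defrel_read M (P : (nat -> M) -> Prop) (r : nat -> nat + M) :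
  defrel P -> defrel (fun e => P (read r e)).
Proof.
move=> [p [s ps]].
exists p, (fun i => match s i with inl j => r j | inr m => inr m end) => e.
rewrite ps; suff -> : read s (read r e) = read
  (fun i => match s i with inl j => r j | inr m => inr m end) e by [].
by apply: funext => i; rewrite /read; case: (s i).
Qed.

Lemma defrel_ren M (P : (nat -> M) -> Prop) (r : nat -> nat) :
  defrel P -> defrel (fun e => P (e \o r)).
Proof. exact: (@defrel_read _ P (fun i => inl (r i))). Qed.

(** The parameters of two relations are merged on even and odd variables. *)
Lemma defrel_imp M (P Q : (nat -> M) -> Prop) :
  defrel P -> defrel Q -> defrel (fun e => P e -> Q e).
Proof.
move=> [p [s ps]] [q [t qt]].
exists (Imp (formula_ren double p) (formula_ren (fun i => i.*2.+1) q)),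
  (fun i => if odd i then t i./2 else s i./2) => e.
have es : read (fun i => if odd i then t i./2 else s i./2) e \o double = read s e.
  by apply: funext => i; rewrite /read /= odd_double doubleK.
have et : read (fun i => if odd i then t i./2 else s i./2) e \o
    (fun i => i.*2.+1) = read t e.
  by apply: funext => i; rewrite /read /= odd_double /= uphalf_double.
by rewrite /= !sat_ren es et ps qt.
Qed.

Lemma defrel_pull M (P : (nat -> M) -> Prop) : defrel P ->
  exists (p : formula L) (s : nat -> nat + M),
    forall a e, P (scons a e) <-> sat (scons a (read s e)) p.
Proof.
move=> [p [s ps]].
(* Variables that read index 0 become the bound variable, the others move up by one. The junk value
   [j.-1] at [j = 0] is never read. *)
exists (formula_ren (fun i => if s i is inl 0%N then 0%N else i.+1) p),
  (fun i => match s i with inl j => inl j.-1 | inr m => inr m end) => a e.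
rewrite ps sat_ren.
set E := _ \o _; suff -> : read s (scons a e) = E by [].
apply: funext => i; rewrite /E /read /=.
by case si: (s i) => [[|j]|m] //=; rewrite si.
Qed.

Lemma defrel_all M (F : M -> (nat -> M) -> Prop) :
  defrel (fun e => F (e 0%N) (fun i => e i.+1)) ->
  defrel (fun e => forall x, F x e).
Proof.
move=> /defrel_pull[p [s ps]].
by exists (All p), s => e /=; split=> H a; [apply/ps|apply/(ps a e)]; exact: H.
Qed.

Lemma defrel_cst M (P : Prop) : defrel (fun _ : nat -> M => P).
Proof.
have [p|np] := pselect P.
- by exists (Imp (Bot L) (Bot L)), inl => e /=; split.
- by exists (Bot L), inl => e /=; split.
Qed.

Lemma defrel_not M (P : (nat -> M) -> Prop) :
  defrel P -> defrel (fun e => ~ P e).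
Proof. by move=> dP; exact: (defrel_imp dP (defrel_cst _ False)). Qed.

Lemma defrel_or M (P Q : (nat -> M) -> Prop) :
  defrel P -> defrel Q -> defrel (fun e => P e \/ Q e).
Proof.
move=> dP dQ; apply: defrel_ext (defrel_imp (defrel_not dP) dQ) => e.
split=> [|[Pe /(_ Pe)|Qe _]//].
by have [Pe _|nP /(_ nP)] := pselect (P e); [left|right].
Qed.

Lemma defrel_and M (P Q : (nat -> M) -> Prop) :
  defrel P -> defrel Q -> defrel (fun e => P e /\ Q e).
Proof.
move=> dP dQ.
apply: defrel_ext (defrel_not (defrel_or (defrel_not dP) (defrel_not dQ))) => e.
by rewrite not_orP !notK.
Qed.

Lemma defrel_iff M (P Q : (nat -> M) -> Prop) :
  defrel P -> defrel Q -> defrel (fun e => P e <-> Q e).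
Proof. by move=> dP dQ; exact: defrel_and (defrel_imp dP dQ) (defrel_imp dQ dP). Qed.

Lemma defrel_ex M (F : M -> (nat -> M) -> Prop) :
  defrel (fun e => F (e 0%N) (fun i => e i.+1)) ->
  defrel (fun e => exists x, F x e).
Proof.
move=> dF; have := @defrel_all _ (fun x e => ~ F x e) (defrel_not dF).
move/defrel_not; apply: defrel_ext => e; split.
- by move=> /existsNP[x /contrapT Fx]; exists x.
- by move=> [x Fx] /(_ x).
Qed.

Lemma defrel_foralln M (n : nat) (P : nat -> (nat -> M) -> Prop) :
  (forall i, defrel (P i)) -> defrel (fun e => forall i, (i < n)%N -> P i e).
Proof.
move=> dP; elim: n => [|n IH].
  by apply: defrel_ext (defrel_cst _ True).
apply: defrel_ext (defrel_and IH (dP n)) => e; split=> [[H Hn] i|H].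
  by rewrite ltnS leq_eqVlt => /predU1P[->//|]; exact: H.
by split=> [i lin|]; apply: H => //; exact: ltnW.
Qed.

(** * Definable functions *)

Definition deffun M (t : (nat -> M) -> M) : Prop :=
  defrel (fun e => t (fun i => e i.+1) = e 0%N).

Lemma deffun_var M i : deffun (fun e : nat -> M => e i).
Proof. by exists (Eq (Var L i.+1) (Var L 0)), inl. Qed.

Lemma deffun_cst M (m : M) : deffun (fun _ : nat -> M => m).
Proof.
by exists (Eq (Var L 1) (Var L 0)), (fun i => if i is 0%N then inl 0%N else inr m).
Qed.

Lemma defrel_app M (A : set M) (t : (nat -> M) -> M) :
  defrel (fun e => A (e 0%N)) -> deffun t -> defrel (fun e => A (t e)).
Proof.
move=> dA dt.
have : defrel (fun e => exists x, t e = x /\ A x).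
  by apply: defrel_ex; exact: defrel_and.
by apply: defrel_ext => e; split=> [[x [-> //]]|]; exists (t e).
Qed.

Lemma defrel_app2 M (B : M -> M -> Prop) (t u : (nat -> M) -> M) :
  defrel (fun e => B (e 0%N) (e 1%N)) -> deffun t -> deffun u ->
  defrel (fun e => B (t e) (u e)).
Proof.
move=> dB dt du.
have : defrel (fun e => exists x, exists y, (t e = x /\ u e = y) /\ B x y).
  apply: defrel_ex; apply: defrel_ex; apply: defrel_and.
    apply: defrel_and.
      by have := defrel_ren (fun i => i.+1) dt.
    by have := defrel_ren (fun i => if i is j.+1 then j.+2 else 0%N) du.
  by have := defrel_ren (fun i => if i is 0%N then 1%N else 0%N) dB.
apply: defrel_ext => e; split=> [[x [y [[-> ->] //]]]|].
by exists (t e), (u e).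
Qed.

Lemma deffun_app M (f : M -> M) (t : (nat -> M) -> M) :
  defrel (fun e => f (e 1%N) = e 0%N) -> deffun t -> deffun (fun e => f (t e)).
Proof.
move=> df dt.
apply: (@defrel_app2 _ (fun y x => f x = y) (fun e => e 0%N)
  (fun e => t (fun i => e i.+1))) => //; first exact: deffun_var.
by have := defrel_ren (fun i => if i is j.+1 then j.+2 else 0%N) dt.
Qed.

Lemma deffun_app2 M (f : M -> M -> M) (t u : (nat -> M) -> M) :
  defrel (fun e => f (e 1%N) (e 2%N) = e 0%N) -> deffun t -> deffun u ->
  deffun (fun e => f (t e) (u e)).
Proof.
move=> df dt du.
have : defrel (fun e => exists x, exists y,
    (t (fun i => e i.+1) = x /\ u (fun i => e i.+1) = y) /\ f x y = e 0%N).
  apply: defrel_ex; apply: defrel_ex; apply: defrel_and.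
    apply: defrel_and.
      by have := defrel_ren (fun i => if i is j.+1 then j.+3 else 1%N) dt.
    by have := defrel_ren (fun i => if i is j.+1 then j.+3 else 0%N) du.
  by have := defrel_ren (fun i => match i with 0 => 2 | 1 => 1 | _ => 0 end%N) df.
apply: defrel_ext => e; split=> [[x [y [[-> ->] //]]]|].
by exists (t (fun i => e i.+1)), (u (fun i => e i.+1)).
Qed.

Lemma defrel_eq M (t u : (nat -> M) -> M) :
  deffun t -> deffun u -> defrel (fun e => t e = u e).
Proof.
apply: (@defrel_app2 _ (fun x y => x = y)).
by exists (Eq (Var L 0) (Var L 1)), inl.
Qed.

Lemma defrel_of_definable M (A : set M) :
  definable A -> defrel (fun e => A (e 0%N)).
Proof.
move=> [p [b ->]].
exists p, (fun i => if i is j.+1 then inr (b j) else inl 0%N) => e /=.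
set E := scons _ _; set E' := read _ _.
by suff -> : E = E' by []; apply: funext => -[].
Qed.

Lemma definable_of_defrel M (m : M) (A : set M) :
  defrel (fun e => A (e 0%N)) -> definable A.
Proof.
move=> /defrel_pull[p [s ps]]; exists p, (read s (fun=> m)); apply/seteqP.
by split=> x /=; rewrite -(ps x (fun=> m)).
Qed.

End Renaming.

(** * Ultrapowers and inp-patterns *)

Section Ultrapower.
Variables (L : language) (M : structure L) (U : set_system nat).
Hypothesis U_ultra : UltraFilter U.

Definition ueq (f g : nat -> M) : Prop := U [set n | f n = g n].

Definition uset : Type := {c : set (nat -> M) | exists f, c = ueq f}.

Definition ucls (f : nat -> M) : uset := exist _ (ueq f) (ex_intro _ f erefl).

Definition urep (c : uset) : nat -> M := sval (cid (svalP c)).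

Lemma ueq_refl f : ueq f f.
Proof. by rewrite /ueq; apply: filterS (@filterT _ U _) => n. Qed.

Lemma ueq_sym f g : ueq f g -> ueq g f.
Proof. by apply: filterS => n /= ->. Qed.

Lemma ueq_trans f g h : ueq f g -> ueq g h -> ueq f h.
Proof. by apply: filterS2 => n /= -> ->. Qed.

Lemma ucls_eq f g : ucls f = ucls g <-> ueq f g.
Proof.
split=> [[->]|fg]; first exact: ueq_refl.
apply: eq_exist => /=; apply/seteqP; split=> h; last exact: ueq_trans.
by apply: ueq_trans; exact: ueq_sym.
Qed.

Lemma urepK c : ucls (urep c) = c.
Proof.
have : ueq (urep c) = sval c by rewrite /urep; case: cid.
by move: (urep c) => f; case: c => c hc /= E; exact: eq_exist.
Qed.

Lemma urep_cls f : ueq (urep (ucls f)) f.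
Proof. by apply/ucls_eq; rewrite urepK. Qed.

(** Symbols act on chosen representatives; [ultra_eval] and [los] show that the choice is
    harmless. *)
Definition ultrapower : structure L :=
  @Structure L uset
    (fun f a => ucls (fun n => fint (fun k => urep (a k) n)))
    (fun r a => U [set n | rint (fun k => urep (a k) n)]).

Lemma ultra_eval (f : nat -> nat -> M) t :
  eval (fun i => ucls (f i) : ultrapower) t =
  ucls (fun n => eval (fun i => f i n) t).
Proof.
elim: t => [//|g ts IH] /=; apply/ucls_eq.
(* Arities are finite, so the equalities for all arguments hold together on a set in [U]. *)
have /filter_forall : forall k, U [set n |
    urep (eval (fun i => ucls (f i) : ultrapower) (ts k)) n =
    eval (fun i => f i n) (ts k)].
  by move=> k; rewrite IH; exact: urep_cls.
by apply: filterS => n /= H; congr fint; exact: funext.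
Qed.

Lemma ultraN (A : set nat) : U (~` A) <-> ~ U A.
Proof.
split=> [UN UA|nUA]; last by have [] := in_ultra_setVsetC A U_ultra.
by apply: (filter_not_empty U); rewrite -(setICl A); exact: filterI.
Qed.

Lemma los p (f : nat -> nat -> M) :
  sat (fun i => ucls (f i) : ultrapower) p <->
  U [set n | sat (fun i => f i n) p].
Proof.
elim: p f => [|t u|s ts|p IHp q IHq|p IHp] f /=.
- by split=> [//|H]; exact: (filter_not_empty U).
- by rewrite !ultra_eval ucls_eq.
- have /filter_forall H : forall k, U [set n |
      urep (eval (fun i => ucls (f i) : ultrapower) (ts k)) n =
      eval (fun i => f i n) (ts k)].
    by move=> k; rewrite ultra_eval; exact: urep_cls.
  by split; apply: filterS2 H => n /= H; rewrite (funext H).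
- rewrite IHp IHq; split=> [pq|]; last first.
    by move=> H Hp; apply: filterS2 H Hp => n; exact.
  have [/pq|/ultraN] := pselect (U [set n | sat (fun i => f i n) p]).
    by apply: filterS => n /= qn _.
  by apply: filterS => n /= np /np.
- have sconsE (a : nat -> M) : scons (ucls a : ultrapower) (fun i => ucls (f i)) =
      fun i => ucls (scons a f i) by apply: funext => -[].
  have sconsE2 (a : nat -> M) n :
      (fun i => scons a f i n) = scons (a n) (fun i => f i n).
    by apply: funext => -[].
  split=> [H|H a]; last first.
    rewrite -(urepK a) sconsE; apply/IHp; apply: filterS H => n /= /(_ (urep a n)).
    by rewrite sconsE2.
  apply: contrapT => /ultraN /= Hn.
  (* A counterexample is picked in every coordinate that has one; the class of this sequence
     contradicts [H]. *)
  have /choice[a an] : forall n, exists a, (exists b,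
      ~ sat (scons b (fun i => f i n)) p) -> ~ sat (scons a (fun i => f i n)) p.
    move=> n; have [[b Hb]|Hb] := pselect (exists b,
      ~ sat (scons b (fun i => f i n)) p); first by exists b.
    by exists (f 0%N n) => /Hb.
  have := H (ucls a); rewrite sconsE IHp => Ha.
  apply: (filter_not_empty U).
  apply: filterS2 Hn Ha => n /= /existsNP/an na.
  by rewrite sconsE2.
Qed.

Definition udiag (x : M) : ultrapower := ucls (fun=> x).

Lemma elementary_udiag : elementary udiag.
Proof.
move=> p e; rewrite (los p (fun i n => e i)).
split=> [H|/filter_ex[]//]; by apply: filterS (@filterT _ U _) => n.
Qed.

End Ultrapower.

Lemma elementary_id (L : language) (M : structure L) : elementary (@id M).
Proof. by move=> p e. Qed.

(** Disjointness of two instances of [p] is a single formula in the merged parameters [e], with [b]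
    on even and [c] on odd indices, so [h] transfers it. *)
Lemma elementary_disjoint (L : language) (M N : structure L) (h : M -> N) p
    (b c : nat -> M) : elementary h ->
  (forall x, sat (scons x b) p -> ~ sat (scons x c) p) ->
  forall x, sat (scons x (h \o b)) p -> ~ sat (scons x (h \o c)) p.
Proof.
move=> eh bc.
pose r i := if i is j.+1 then j.*2.+1 else 0%N.
pose q := All (Imp (formula_ren r p) (Imp (formula_ren (ren_up (fun j => j.*2.+1)) p)
  (Bot L))).
pose e i := if odd i then c i./2 else b i./2.
have er (K : structure L) (g : M -> K) x : scons x (g \o e) \o r = scons x (g \o b).
  by apply: funext => -[|i] //=; rewrite /e odd_double doubleK.
have er' (K : structure L) (g : M -> K) x :
    scons x (g \o e) \o ren_up (fun j => j.*2.+1) = scons x (g \o c).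
  by apply: funext => -[|i] //=; rewrite /e /= odd_double /= uphalf_double.
have : sat e q.
  by rewrite /q /= => x; rewrite !sat_ren (er M id) (er' M id) => /bc.
by rewrite eh /q /= => + x => /(_ x); rewrite !sat_ren er er'.
Qed.

(** The pattern lives in an ultrapower of [M]. *)
Lemma inp_pattern_of_finite (L : language) (M : structure L) (m : nat)
    (Q : 'I_m.+1 -> (nat -> M) -> Prop) :
  (forall i, defrel (Q i)) ->
  (forall n, exists b : 'I_m.+1 -> nat -> nat -> M,
    (forall i j k x, (j < n)%N -> (k < n)%N -> j <> k ->
       Q i (scons x (b i j)) -> ~ Q i (scons x (b i k))) /\
    (forall f : 'I_m.+1 -> nat, (forall i, f i < n)%N ->
       exists x, forall i, Q i (scons x (b i (f i))))) ->
  has_inp_pattern M 'I_m.+1.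
Proof.
move=> dQ /choice[b bP].
(* [U] contains every final segment, so what holds in the finite arrays for all large [n] holds in
   the ultrapower. *)
have [U [U_ultra sU]] := ultraFilterLemma (eventually_filter).
have Uge k : U [set n | (k <= n)%N] by apply: sU; exists k.
have /choice[p /choice[s ps]] := fun i => defrel_pull (dQ i).
pose B i j v : ultrapower M U := ucls U (fun n => read (s i) (b n i j) v).
have satB i j (x : nat -> M) : sat (scons (ucls U x : ultrapower M U) (B i j)) (p i) <->
    U [set n | Q i (scons (x n) (b n i j))].
  have -> : scons (ucls U x : ultrapower M U) (B i j) =
     fun v => ucls U (scons x (fun v n => read (s i) (b n i j) v) v).
    by apply: funext => -[].
  rewrite los.
  suff E n : (fun v => scons x (fun v n => read (s i) (b n i j) v) v n) =
      scons (x n) (read (s i) (b n i j)).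
    by split; apply: filterS => n /=; rewrite ps E.
  by apply: funext => -[].
exists (ultrapower M U), (@udiag L M U); split; first exact: elementary_udiag.
(* Instances in one row are pairwise disjoint, so each row is 2-inconsistent. *)
exists p, B, (fun=> 2%N); split=> [i s' s'_inj [N [h [eh [x Hx]]]]|f].
  have x0 : sat (scons x (h \o B i (s' ord0))) (p i).
    by apply: (Hx (p i, B i (s' ord0))); exists ord0.
  have x1 : sat (scons x (h \o B i (s' ord_max))) (p i).
    by apply: (Hx (p i, B i (s' ord_max))); exists ord_max.
  move: x0 x1; apply: elementary_disjoint => // y.
  rewrite -(urepK y) !satB => y0 y1.
  apply: (filter_not_empty U).
  apply: filterS3 y0 y1 (Uge (maxn (s' ord0) (s' ord_max)).+1) => n /= y0 y1.
  rewrite gtn_max => /andP[l0 l1].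
  have [dis _] := bP n; apply: dis y0 y1 => //.
  by move/s'_inj.
exists (ultrapower M U), id; split; first exact: elementary_id.
(* There are finitely many rows, so the path [f] is bounded and every array with [n >= k] realizes
   it. *)
pose k := (\max_i f i).+1.
have /choice[x xP] : forall n, exists x, (k <= n)%N ->
    forall i, Q i (scons x (b n i (f i))).
  move=> n; have [kn|_] := leqP k n; last by exists (b n ord0 0%N 0%N).
  have [_ /(_ f)[i|x Hx]] := bP n; last by exists x.
  by apply: leq_trans kn; rewrite ltnS; exact: (leq_bigmax i).
exists (ucls U x) => _ [i _ <-] /=; apply/satB.
by apply: filterS (Uge k) => n /= /xP.
Qed.

Lemma burden_le_finite (L : language) (M : structure L) (m : nat)
    (Q : 'I_m.+1 -> (nat -> M) -> Prop) :
  burden_le M m -> (forall i, defrel (Q i)) ->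
  ~ (forall n, exists b : 'I_m.+1 -> nat -> nat -> M,
    (forall i j k x, (j < n)%N -> (k < n)%N -> j <> k ->
       Q i (scons x (b i j)) -> ~ Q i (scons x (b i k))) /\
    (forall f : 'I_m.+1 -> nat, (forall i, f i < n)%N ->
       exists x, forall i, Q i (scons x (b i (f i))))).
Proof.
move=> Mm dQ /(inp_pattern_of_finite dQ)/Mm.
by rewrite (card_le_eql (card_esym card_II)) card_le_II ltnn.
Qed.

(** * Linear arithmetic in ordered Abelian groups *)

(** Fourier-Motzkin elimination on constraints [0 <= v] ([0 < v] when flagged
    [true]), where [v] lists the integer coefficients of the variables. *)
Section LinearArithmetic.

Definition lin_add :=
  fix add (u v : seq int) : seq int :=
    match u, v with
    | a :: u', b :: v' => a + b :: add u' v'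
    | [::], _ => v
    | _, [::] => u
    end.

Definition lin_mul (k : nat) (v : seq int) : seq int := [seq c * k%:Z | c <- v].

Inductive lin_expr :=
| LVar of nat
| LZero
| LAdd of lin_expr & lin_expr
| LOpp of lin_expr
| LMul of lin_expr & nat.

Fixpoint linearize (t : lin_expr) : seq int :=
  match t with
  | LVar n => ncons n 0 [:: 1]
  | LZero => [::]
  | LAdd t u => lin_add (linearize t) (linearize u)
  | LOpp t => [seq - c | c <- linearize t]
  | LMul t n => lin_mul n (linearize t)
  end.

Definition fm_pos (c : bool * seq int) : bool :=
  if head 0 c.2 is Posz n.+1 then true else false.

Definition fm_neg (c : bool * seq int) : bool :=
  if head 0 c.2 is Negz _ then true else false.

(** Each constraint is multiplied by the absolute value of the other's head coefficient, so that the
    heads cancel; the sum is strict as soon as one summand is. *)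
Definition fm_combine (p q : bool * seq int) : bool * seq int :=
  (p.1 || q.1, behead (lin_add (lin_mul `|head 0 q.2| p.2) (lin_mul `|head 0 p.2| q.2))).

Definition fm_step (cs : seq (bool * seq int)) : seq (bool * seq int) :=
  undup ([seq (c.1, behead c.2) | c <- cs & head 0 c.2 == 0] ++
    [seq fm_combine p q | p <- [seq c <- cs | fm_pos c], q <- [seq c <- cs | fm_neg c]]).

(** With no variable left, a strict constraint reads [0 < 0]. *)
Fixpoint fm_refutes (n : nat) (cs : seq (bool * seq int)) : bool :=
  if n is n'.+1 then fm_refutes n' (fm_step cs) else has fst cs.

(** * Soundness of the elimination *)

Variable R : porderZmodType.
Hypothesis R_oag : divisible_oag R.
Implicit Types (x y z : R) (env : seq R).

Lemma oag_le_total x y : (x <= y) || (y <= x).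
Proof. by case: R_oag => H _ _; exact: H. Qed.

Lemma oag_ltNge x y : (x < y) = ~~ (y <= x).
Proof.
have [xy|/negPf nxy] := boolP (x <= y); last first.
  by have := oag_le_total x y; rewrite nxy lt_neqAle nxy andbF => /= ->.
by rewrite lt_leAnge xy.
Qed.

Lemma oag_leNgt x y : (x <= y) = ~~ (y < x).
Proof. by rewrite oag_ltNge negbK. Qed.

Lemma oag_addr_ge0 x y : 0 <= x -> 0 <= y -> 0 <= x + y.
Proof.
move=> x0 y0; apply: (le_trans y0).
by rewrite -{1}(add0r y); case: R_oag => _ H _; exact: H.
Qed.

Lemma oag_addr_gt0 x y : 0 < x -> 0 <= y -> 0 < x + y.
Proof.
move=> x0 y0; apply: (lt_le_trans x0).
by rewrite addrC -{1}(add0r x); case: R_oag => _ H _; exact: H.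
Qed.

Lemma oag_mulrn_ge0 x n : 0 <= x -> 0 <= x *+ n.
Proof.
by move=> x0; elim: n => [|n IH]; rewrite ?mulr0n// mulrS oag_addr_ge0.
Qed.

Lemma oag_mulrn_gt0 x n : 0 < x -> (0 < n)%N -> 0 < x *+ n.
Proof.
by case: n => // n x0 _; rewrite mulrS oag_addr_gt0// oag_mulrn_ge0// ltW.
Qed.

Lemma oag_subr_ge0 x y : (0 <= y - x) = (x <= y).
Proof.
case: R_oag => _ H _; apply/idP/idP => [/(H _ _ x)|/(H _ _ (- x))].
  by rewrite add0r subrK.
by rewrite subrr.
Qed.

Lemma oag_subr_gt0 x y : (0 < y - x) = (x < y).
Proof. by rewrite !lt_neqAle oag_subr_ge0 eq_sym subr_eq0 eq_sym. Qed.

Fixpoint lin_val env (v : seq int) : R :=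
  match env, v with
  | x :: env', c :: v' => x *~ c + lin_val env' v'
  | _, _ => 0
  end.

Fixpoint lin_eval env (t : lin_expr) : R :=
  match t with
  | LVar n => nth 0 env n
  | LZero => 0
  | LAdd t u => lin_eval env t + lin_eval env u
  | LOpp t => - lin_eval env t
  | LMul t n => lin_eval env t *+ n
  end.

Lemma lin_val0 env : lin_val env [::] = 0.
Proof. by case: env. Qed.

Lemma lin_val_add env u v : lin_val env (lin_add u v) = lin_val env u + lin_val env v.
Proof.
elim: env u v => [|x env IH] [|a u] [|b v] //=; rewrite ?addr0 ?add0r//.
by rewrite IH mulrzDr addrACA.
Qed.

Lemma lin_val_mul env k v : lin_val env (lin_mul k v) = lin_val env v *+ k.
Proof.
elim: env v => [|x env IH] [|a v] //=; rewrite ?mul0rn//.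
by rewrite IH mulrnDl mulrzA.
Qed.

Lemma lin_val_opp env v : lin_val env [seq - c | c <- v] = - lin_val env v.
Proof.
elim: env v => [|x env IH] [|a v] //=; rewrite ?oppr0//.
by rewrite IH opprD mulrNz.
Qed.

Lemma lin_val_linearize env t : lin_val env (linearize t) = lin_eval env t.
Proof.
elim: t => [n||t IHt u IHu|t IHt|t IHt n] /=.
- elim: n env => [|n IH] [|x env] //=; first by rewrite lin_val0 addr0.
  by rewrite IH mulr0z add0r.
- by rewrite lin_val0.
- by rewrite lin_val_add IHt IHu.
- by rewrite lin_val_opp IHt.
- by rewrite lin_val_mul IHt.
Qed.

Definition lin_holds env (c : bool * seq int) : bool :=
  if c.1 then 0 < lin_val env c.2 else 0 <= lin_val env c.2.

Lemma lin_holds_ge0 env c : lin_holds env c -> 0 <= lin_val env c.2.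
Proof. by rewrite /lin_holds; case: c.1 => // /ltW. Qed.

Lemma lin_val_cons x env v :
  lin_val (x :: env) v = x *~ head 0 v + lin_val env (behead v).
Proof. by case: v => [|c v] //=; rewrite lin_val0 mulr0z addr0. Qed.

Lemma fm_combineP x env p q : fm_pos p -> fm_neg q ->
  lin_holds (x :: env) p -> lin_holds (x :: env) q -> lin_holds env (fm_combine p q).
Proof.
move=> pp qn Hp Hq; rewrite /fm_combine.
set a := `|head 0%R q.2|%N; set b := `|head 0%R p.2|%N.
have a0 : (0 < a)%N by move: qn; rewrite /a /fm_neg; case: (head 0 q.2).
have b0 : (0 < b)%N by move: pp; rewrite /b /fm_pos; case: (head 0 p.2) => [[]|].
have h0 : head 0 (lin_add (lin_mul a p.2) (lin_mul b q.2)) = 0.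
  move: pp qn; rewrite /fm_pos /fm_neg /a /b.
  case: p.2 => [|c u] //=; case: q.2 => [|d v] //=.
  by case: c => [[|c]|c] //; case: d => [|d] // _ _; rewrite NegzE absz_nat abszN mulNr mulrC subrr.
have e : lin_val env (behead (lin_add (lin_mul a p.2) (lin_mul b q.2))) =
    lin_val (x :: env) p.2 *+ a + lin_val (x :: env) q.2 *+ b.
  by rewrite -!lin_val_mul -lin_val_add (lin_val_cons _ _ (lin_add _ _)) h0 mulr0z add0r.
rewrite /lin_holds /= e.
have Hp0 := oag_mulrn_ge0 a (lin_holds_ge0 Hp).
have Hq0 := oag_mulrn_ge0 b (lin_holds_ge0 Hq).
move: Hp Hq; rewrite /lin_holds; case: p.1 => /= [Hp _|_].
  by apply: oag_addr_gt0 => //; exact: oag_mulrn_gt0.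
case: q.1 => /= [Hq|_]; last exact: oag_addr_ge0.
by rewrite addrC; apply: oag_addr_gt0 => //; exact: oag_mulrn_gt0.
Qed.

Lemma fm_refutesP env cs : fm_refutes (size env) cs -> all (lin_holds env) cs -> False.
Proof.
elim: env cs => [|x env IH] cs /=.
  by move=> /hasP[c ccs c1] /allP /(_ _ ccs); rewrite /lin_holds c1 /= ltxx.
move=> /IH {}IH /allP H; apply: IH; apply/allP => c.
rewrite mem_undup mem_cat => /orP[/mapP[d]|/allpairsP[[p q] /= []]].
  rewrite mem_filter => /andP[/eqP d0 /H] + ->.
  by rewrite /lin_holds lin_val_cons d0 mulr0z add0r.
rewrite !mem_filter => /andP[pp /H Hp] /andP[qn /H Hq] ->.
exact: fm_combineP Hp Hq.
Qed.

(** An iterated implication ending in [False]: the shape of the goal once [oag_refute] has reverted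
    the hypotheses, so that [change] can reify it. *)
Fixpoint lin_chain env (cs : seq (bool * lin_expr)) : Prop :=
  match cs with
  | [::] => False
  | (true, t) :: cs' => 0 < lin_eval env t -> lin_chain env cs'
  | (false, t) :: cs' => 0 <= lin_eval env t -> lin_chain env cs'
  end.

Lemma lin_chainP env cs :
  fm_refutes (size env) [seq (c.1, linearize c.2) | c <- cs] -> lin_chain env cs.
Proof.
move=> /fm_refutesP H.
suff : (all (lin_holds env) [seq (c.1, linearize c.2) | c <- cs] -> False) ->
  lin_chain env cs by apply.
elim: cs {H} => [|[[] t] cs IH] /=; first exact.
all: rewrite /lin_holds /= lin_val_linearize => H Ht; apply: IH => Hcs.
all: by apply: H; rewrite Ht.
Qed.

End LinearArithmetic.

(** Atoms are compared up to conversion: the same term can come with different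
    paths through the algebraic hierarchy. *)
Ltac lin_mem x l :=
  lazymatch l with
  | [::] => constr:(false)
  | ?y :: ?l' =>
      match goal with
      | _ => let _ := match goal with _ => unify x y end in constr:(true)
      | _ => lin_mem x l'
      end
  end.

Ltac lin_index x l :=
  lazymatch l with
  | ?y :: ?l' =>
      match goal with
      | _ => let _ := match goal with _ => unify x y end in constr:(0%N)
      | _ => let n := lin_index x l' in constr:(S n)
      end
  end.

Ltac lin_numeral n :=
  lazymatch n with
  | O => constr:(true)
  | S ?m => lin_numeral m
  | _ => constr:(false)
  end.

Ltac lin_atom l t := lazymatch lin_mem t l with true => l | _ => constr:(t :: l) end.

Ltac lin_atoms l t :=
  lazymatch t with
  | (?a + ?b)%R => let l := lin_atoms l a in lin_atoms l b
  | (- ?a)%R => lin_atoms l a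
  | 0%R => l
  | (?a *+ ?n)%R =>
      lazymatch lin_numeral n with true => lin_atoms l a | _ => lin_atom l t end
  | _ => lin_atom l t
  end.

Ltac lin_reify l t :=
  lazymatch t with
  | (?a + ?b)%R => let u := lin_reify l a in let v := lin_reify l b in constr:(LAdd u v)
  | (- ?a)%R => let u := lin_reify l a in constr:(LOpp u)
  | 0%R => constr:(LZero)
  | (?a *+ ?n)%R =>
      lazymatch lin_numeral n with
      | true => let u := lin_reify l a in constr:(LMul u n)
      | _ => let n := lin_index t l in constr:(LVar n)
      end
  | _ => let n := lin_index t l in constr:(LVar n)
  end.

Ltac lin_goal_atoms l G :=
  lazymatch G with
  | is_true (0 < ?t)%R -> ?G' => let l := lin_atoms l t in lin_goal_atoms l G'
  | is_true (0 <= ?t)%R -> ?G' => let l := lin_atoms l t in lin_goal_atoms l G'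
  | _ => l
  end.

Ltac lin_goal_reify l G :=
  lazymatch G with
  | is_true (0 < ?t)%R -> ?G' =>
      let u := lin_reify l t in let c := lin_goal_reify l G' in constr:((true, u) :: c)
  | is_true (0 <= ?t)%R -> ?G' =>
      let u := lin_reify l t in let c := lin_goal_reify l G' in constr:((false, u) :: c)
  | _ => constr:(@nil (bool * lin_expr))
  end.

Lemma oag_eqP (R : porderZmodType) (x y : R) : x = y -> x <= y /\ y <= x.
Proof. by move=> ->; rewrite lexx. Qed.

(** [oag H] proves linear consequences of the hypotheses that are inequalities
    and equalities in the ordered group satisfying [H : divisible_oag R]. *)
Ltac oag_refute H :=
  match type of H with divisible_oag ?R =>
    repeat match goal with
    | h : @eq ?T ?x ?y |- _ => unify T (Num.POrderedZmodule.sort R);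
        let h1 := fresh in let h2 := fresh in
        destruct (@oag_eqP R x y h) as [h1 h2]; clear h
    end;
    repeat match goal with
    | h : is_true (@Order.lt _ ?T ?x ?y) |- _ => rewrite -(oag_subr_gt0 H) in h; move: h
    | h : is_true (@Order.le _ ?T ?x ?y) |- _ => rewrite -(oag_subr_ge0 H) in h; move: h
    end;
    match goal with |- ?G =>
      let l := lin_goal_atoms (@nil R) G in
      let c := lin_goal_reify l G in
      change (lin_chain l c); apply: (lin_chainP H); first [vm_compute; reflexivity | fail 2 "no linear refutation"]
    end
  end.

Ltac oag H :=
  lazymatch goal with
  | |- is_true (@Order.lt _ _ _ _) => rewrite (oag_ltNge H); apply/negP => ?; oag_refute H
  | |- is_true (@Order.le _ _ _ _) => rewrite (oag_leNgt H); apply/negP => ?; oag_refute H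
  | |- @eq _ _ _ => apply: le_anti; apply/andP; split; oag H
  | |- False => oag_refute H
  | |- _ => exfalso; oag_refute H
  end.

(** * Definability in expansions of ordered groups *)

Section OrderedGroupDefinability.
Variables (R : porderZmodType) (L : language) (I : interpretation L R).
Local Notation M := (og_expansion I).

Lemma defrel_lt (t u : (nat -> M) -> M) : deffun t -> deffun u ->
  defrel (fun e => (t e : R) < (u e : R)).
Proof.
apply: (@defrel_app2 _ M (fun x y : R => x < y)).
exists (@Rel (og_language L) None (fun i : 'I_2 => Var _ i)), inl => e.
by rewrite /read /=.
Qed.

Lemma defrel_le (t u : (nat -> M) -> M) : deffun t -> deffun u ->
  defrel (fun e => (t e : R) <= (u e : R)).
Proof.
move=> dt du; apply: defrel_ext (defrel_or (defrel_lt dt du) (defrel_eq dt du)) => e.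
rewrite le_eqVlt; split=> [[->|->]|/predU1P[->|->]]; rewrite ?eqxx ?orbT//.
  by right.
by left.
Qed.

Lemma deffun_add (t u : (nat -> M) -> M) : deffun t -> deffun u ->
  @deffun _ M (fun e => (t e : R) + (u e : R)).
Proof.
apply: (@deffun_app2 _ M (fun x y : R => x + y)).
exists (Eq (@App (og_language L) None (fun i : 'I_2 => Var _ i.+1)) (Var _ 0)), inl => e.
by rewrite /read /=.
Qed.

Lemma deffun_opp (t : (nat -> M) -> M) : deffun t ->
  @deffun _ M (fun e => - (t e : R)).
Proof.
apply: (@deffun_app _ M (fun x : R => - x)).
apply: defrel_ext (defrel_eq (deffun_add (deffun_var M 1) (deffun_var M 0))
  (@deffun_cst _ M (0 : R))) => e /=; split=> [|<-]; last by rewrite subrr.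
by move/(canRL (addKr _)); rewrite addr0 => ->.
Qed.

Lemma deffun_mulrn (t : (nat -> M) -> M) n : deffun t ->
  @deffun _ M (fun e => (t e : R) *+ n).
Proof.
move=> dt; elim: n => [|n IH]; first exact: deffun_cst.
rewrite (_ : (fun e => _) = (fun e => (t e : R) + (t e : R) *+ n)).
  exact: deffun_add.
by apply: funext => e; rewrite mulrS.
Qed.

End OrderedGroupDefinability.

Create HintDb definability.

(** Proves definability of relations and functions written with the connectives,
    the quantifiers, the order, the group operations, and sets, relations and
    functions whose definability is a hypothesis or a hint. *)
Ltac dfun :=
  cbv beta; first
  [ assumption
  | solve [auto 2 with definability nocore]
  | lazymatch goal with
    | |- @deffun ?L ?M (fun e => e ?i) => exact: deffun_var
    | |- @deffun ?L ?M (fun _ => ?c) => exact: deffun_cst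
    | |- @deffun ?L ?M (fun e => (@?t e + @?u e)%R) => refine (@deffun_add _ _ _ t u _ _); dfun
    | |- @deffun ?L ?M (fun e => (- @?t e)%R) => refine (@deffun_opp _ _ _ t _); dfun
    | |- @deffun ?L ?M (fun e => (@?t e *+ ?n)%R) => refine (@deffun_mulrn _ _ _ t n _); dfun
    | |- @deffun ?L ?M (fun e => ?f (@?t e)) =>
        refine (@deffun_app L M f t _ _); [solve [auto 2 with definability nocore] | dfun]
    end ].

Ltac drel :=
  cbv beta; first
  [ assumption
  | solve [auto 2 with definability nocore]
  | lazymatch goal with
    | |- @defrel ?L ?M (fun _ => ?P) => exact: defrel_cst
    | |- @defrel ?L ?M (fun e => @?P e /\ @?Q e) => refine (@defrel_and L M P Q _ _); drel
    | |- @defrel ?L ?M (fun e => @?P e \/ @?Q e) => refine (@defrel_or L M P Q _ _); drel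
    | |- @defrel ?L ?M (fun e => @?P e <-> @?Q e) => refine (@defrel_iff L M P Q _ _); drel
    | |- @defrel ?L ?M (fun e => forall i : nat, is_true (i < ?n)%N -> @?P e i) =>
        refine (@defrel_foralln L M n (fun i e => P e i) _); let i := fresh in intro i; drel
    | |- @defrel ?L ?M (fun e => ~ @?P e) => refine (@defrel_not L M P _); drel
    | |- @defrel ?L ?M (fun e => @?P e -> @?Q e) => refine (@defrel_imp L M P Q _ _); drel
    | |- @defrel ?L ?M (fun e => exists x, @?F e x) =>
        refine (@defrel_ex L M (fun x e => F e x) _); drel
    | |- @defrel ?L ?M (fun e => forall x, @?F e x) =>
        refine (@defrel_all L M (fun x e => F e x) _); drel
    | |- @defrel ?L ?M (fun e => is_true (@?t e < @?u e)%R) =>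
        refine (@defrel_lt _ _ _ t u _ _); dfun
    | |- @defrel ?L ?M (fun e => is_true (@?t e <= @?u e)%R) =>
        refine (@defrel_le _ _ _ t u _ _); dfun
    | |- @defrel ?L ?M (fun e => @?t e = @?u e) => refine (@defrel_eq L M t u _ _); dfun
    | |- _ => first
        [ lazymatch goal with |- @defrel ?L ?M (fun e => ?B (@?t e) (@?u e)) =>
            refine (@defrel_app2 L M B t u _ _ _);
            [solve [assumption | auto 2 with definability nocore] | dfun | dfun] end
        | lazymatch goal with |- @defrel ?L ?M (fun e => ?A (@?t e)) =>
            refine (@defrel_app L M A t _ _);
            [solve [assumption | auto 2 with definability nocore] | dfun] end ]
    end ].

Section Expansion.
Variables (R : porderZmodType) (L : language) (I : interpretation L R).
Local Notation M := (og_expansion I).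

Definition dset (A : set R) : Prop := @defrel _ M (fun e => A (e 0%N)).

Lemma defrel_succ_in (D : set R) : dset D ->
  @defrel _ M (fun e => succ_in D (e 0%N) (e 1%N)).
Proof.
rewrite /dset => dD.
apply: (@defrel_ext _ M (fun e => D (e 1%N) /\ (e 0%N : R) < (e 1%N : R) /\
  forall c : R, D c -> (e 0%N : R) < c -> (e 1%N : R) <= c)); last by drel.
by move=> e; split=> [[? []]|[]]; split.
Qed.

Lemma defrel_opp (D : set R) : dset D -> dset (fun x => D (- x)).
Proof. by rewrite /dset => dD; drel. Qed.

End Expansion.

(** * Patterns in expansions of burden at most 2 *)

Definition separated (R : porderZmodType) (d : R) (A : set R) : Prop :=
  forall x y, A x -> A y -> x < y -> x + d <= y.

Section Burden2.
Variables (R : porderZmodType) (L : language) (I : interpretation L R).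
Hypothesis R_oag : divisible_oag R.
Local Notation M := (og_expansion I).
Hypothesis R_burden : burden_le M 2.

Lemma oag_lt_total (x y : R) : [\/ x = y, x < y | y < x].
Proof.
have := oag_le_total R_oag x y; rewrite !le_eqVlt (eq_sym y x).
by have [->|_ /= /orP[]] := eqVneq x y; [constructor 1|constructor 2|constructor 3].
Qed.

Lemma oag_lerMn (x : R) (m n : nat) : 0 <= x -> (m <= n)%N -> x *+ m <= x *+ n.
Proof.
move=> x0 mn; rewrite -(subnKC mn) mulrnDr.
have H := oag_mulrn_ge0 R_oag (n - m) x0; oag R_oag.
Qed.

Lemma oag_exists_fraction (d : R) (n : nat) : 0 < d -> exists2 y, 0 < y & y *+ n <= d.
Proof.
move=> d0; have [y yd] := oag_divisible R_oag d (ltn0Sn n).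
have y0 : 0 < y.
  rewrite (oag_ltNge R_oag); apply/negP => y0.
  have : 0 <= (- y) *+ n.+1 by apply: (oag_mulrn_ge0 R_oag); oag R_oag.
  by rewrite mulNrn yd => ?; oag R_oag.
by exists y => //; rewrite -yd; apply: oag_lerMn; [exact: ltW|].
Qed.

Lemma separated_inj (d : R) (A : set R) x y : separated d A ->
  A x -> A y -> x < y + d -> y < x + d -> x = y.
Proof.
move=> sA Ax Ay xy yx; have [//|lt|lt] := oag_lt_total x y.
  by have := sA _ _ Ax Ay lt => ?; oag R_oag.
by have := sA _ _ Ay Ax lt => ?; oag R_oag.
Qed.

(** Uniformly definable families of subsets of [R], the second argument carrying the parameters. *)
Definition defpar (P : R -> (nat -> R) -> Prop) : Prop :=
  @defrel _ M (fun e => P (e 0%N) (fun i => e i.+1)).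

(** The form in which burden at most 2 is used: finite arrays of every size suffice, because the
    ultrapower glues them into one pattern. *)
Lemma three_rows (Q0 Q1 Q2 : R -> (nat -> R) -> Prop) :
  defpar Q0 -> defpar Q1 -> defpar Q2 ->
  ~ (forall n, exists b0 b1 b2 : nat -> nat -> R,
    [/\ forall j k x, (j < k < n)%N -> Q0 x (b0 j) -> ~ Q0 x (b0 k),
        forall j k x, (j < k < n)%N -> Q1 x (b1 j) -> ~ Q1 x (b1 k),
        forall j k x, (j < k < n)%N -> Q2 x (b2 j) -> ~ Q2 x (b2 k) &
        forall i j k, (i < n)%N -> (j < n)%N -> (k < n)%N ->
          exists x, [/\ Q0 x (b0 i), Q1 x (b1 j) & Q2 x (b2 k)]]).
Proof.
move=> d0 d1 d2 H.
pose Q (i : 'I_3) (e : nat -> M) := match val i with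
  0%N => Q0 (e 0%N) (fun i => e i.+1) | 1%N => Q1 (e 0%N) (fun i => e i.+1)
  | _ => Q2 (e 0%N) (fun i => e i.+1) end.
apply: (@burden_le_finite _ M 2 Q) => //; first by move=> [[|[|[]]]].
move=> n; have [b0 [b1 [b2 [D0 D1 D2 C]]]] := H n.
exists (fun i => match val i with 0%N => b0 | 1%N => b1 | _ => b2 end); split.
  move=> i j k x jn kn /eqP; rewrite neq_ltn => jk Qj Qk; move: jk.
  case: i Qj Qk => -[|[|[|//]]] i; rewrite /Q /= => Qj Qk /orP[] jk.
  - by apply: (D0 j k x) => //; rewrite jk.
  - by apply: (D0 k j x) => //; rewrite jk.
  - by apply: (D1 j k x) => //; rewrite jk.
  - by apply: (D1 k j x) => //; rewrite jk.
  - by apply: (D2 j k x) => //; rewrite jk.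
  - by apply: (D2 k j x) => //; rewrite jk.
move=> f fn; have [x [X0 X1 X2]] := C _ _ _ (fn ord0) (fn (inord 1)) (fn ord_max).
exists x => i; rewrite /Q.
have [i0|i0|i0] : [\/ i = ord0, i = inord 1 | i = ord_max].
- case: i => -[|[|[|//]]] i; [constructor 1|constructor 2|constructor 3];
    by apply: val_inj; rewrite /= ?inordK.
- by rewrite i0.
- by rewrite i0 (_ : val _ = 1%N) //= inordK.
- by rewrite i0.
Qed.

(** Thickening a family by an interval with movable endpoints yields rows for both patterns
    below. *)
Lemma defpar_row1 (P : R -> (nat -> R) -> Prop) : defpar P ->
  defpar (fun x e => exists d,
    P d (fun i => e i.+2) /\ d + e 0%N <= x /\ x < d + e 1%N).
Proof.
move=> dP; rewrite /defpar.
refine (@defrel_ex _ M _ _); cbv beta.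
refine (@defrel_and _ M _ _ _ _); last by drel.
by have := defrel_ren (fun i => if i is j.+1 then j.+4 else 0%N) dP.
Qed.

(** A point of [P1 + P2 + [0, d2)] determines its three summands. The rows prescribe the summand in
    [P1], the summand in [P2] and the position in [[0, d2)] independently. *)
Lemma nested_separated (P1 P2 : R -> (nat -> R) -> Prop) :
  defpar P1 -> defpar P2 ->
  ~ (forall n, exists (b : nat -> R) (d1 d2 : R) (f g : nat -> R),
    [/\ 0 < d2, separated d1 (P1^~ b), separated d2 (P2^~ b),
        forall y, P2 y b -> 0 <= y /\ y + d2 <= d1 &
        (forall i, (i < n)%N -> P1 (f i) b /\ P2 (g i) b) /\
        (forall i j, (i < j < n)%N -> f i <> f j /\ g i <> g j)]).
Proof.
move=> dP1 dP2 H.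
pose Q0 x (e : nat -> R) := e 0%N <= x /\ x < e 1%N.
pose Q1 x (e : nat -> R) := exists d,
  P1 d (fun i => e i.+2) /\ d + e 0%N <= x /\ x < d + e 1%N.
pose P12 x (e : nat -> R) := exists d, P1 d e /\ exists y, P2 y e /\ x = d + y.
pose Q2 x (e : nat -> R) := exists d,
  P12 d (fun i => e i.+2) /\ d + e 0%N <= x /\ x < d + e 1%N.
apply: (@three_rows Q0 Q1 Q2).
- by rewrite /defpar /Q0; drel.
- exact: defpar_row1.
- apply: defpar_row1; rewrite /defpar /P12.
  refine (@defrel_ex _ M _ _); cbv beta; refine (@defrel_and _ M _ _ _ _).
    by have := defrel_ren (fun i => if i is j.+1 then j.+2 else 0%N) dP1.
  refine (@defrel_ex _ M _ _); cbv beta; refine (@defrel_and _ M _ _ _ _).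
    by have := defrel_ren (fun i => if i is j.+1 then j.+3 else 0%N) dP2.
  by drel.
move=> n; have [b [d1 [d2 [f [g [d20 s1 s2 P2d [fg fgn]]]]]]] := H n.
have [y y0 yd] := oag_exists_fraction n d20.
pose pr u v := scons u (scons v b).
(* The rows are the intervals of length [d1] at [f j], the thickenings of [P1] by intervals of
   length [d2] at [g k], and those of [P1 + P2] by [n] consecutive pieces of length [y] inside
   [[0, d2)]. *)
exists (fun j => pr (f j) (f j + d1)), (fun k => pr (g k) (g k + d2)),
  (fun l => pr (y *+ l) (y *+ l.+1)).
have lt_n j k : (j < k < n)%N -> (j < n)%N /\ (k < n)%N.
  by case/andP=> jk kn; split=> //; exact: ltn_trans kn.
have yk k : (k < n)%N -> 0 <= y *+ k /\ y *+ k.+1 <= d2.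
  move=> kn; split; first exact: (oag_mulrn_ge0 R_oag _ (ltW y0)).
  by apply: le_trans yd; apply: oag_lerMn => //; exact: ltW.
have P1E d e : P1 d b -> P1 e b -> forall x, d <= x -> x < d + d1 -> e <= x ->
    x < e + d1 -> d = e.
  move=> Pd Pe x h1 h2 h3 h4.
  by apply: (separated_inj s1 Pd Pe); oag R_oag.
have P2E d e : P2 d b -> P2 e b -> forall x, d <= x -> x < d + d2 -> e <= x ->
    x < e + d2 -> d = e.
  move=> Pd Pe x h1 h2 h3 h4.
  by apply: (separated_inj s2 Pd Pe); oag R_oag.
split=> [j k x jk|j k x jk|j k x jk|i j k ilt jlt klt]; rewrite /Q0 /Q1 /Q2 /pr /=.
- move=> [h1 h2] [h3 h4]; have [jn kn] := lt_n _ _ jk; have [+ _] := fgn _ _ jk; apply.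
  have [fj _] := fg _ jn; have [fk _] := fg _ kn.
  by apply: (P1E _ _ fj fk x).
- move=> [d [Pd [h1 h2]]] [e [Pe [h3 h4]]].
  have [jn kn] := lt_n _ _ jk; have [_ +] := fgn _ _ jk; apply.
  have [_ gj] := fg _ jn; have [_ gk] := fg _ kn.
  have [? ?] := P2d _ gj; have [? ?] := P2d _ gk.
  have de : d = e by apply: (P1E _ _ Pd Pe x); oag R_oag.
  by rewrite de in h1 h2; apply: (P2E _ _ gj gk (x - e)); oag R_oag.
- move=> [_ [[d [Pd [r [Pr ->]]]] [h1 h2]]] [_ [[e [Pe [t [Pt ->]]]] [h3 h4]]].
  have [jn kn] := lt_n _ _ jk.
  have [? ?] := P2d _ Pr; have [? ?] := P2d _ Pt.
  have [? ?] := yk _ jn; have [? ?] := yk _ kn.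
  have de : d = e by apply: (P1E _ _ Pd Pe x); oag R_oag.
  rewrite de in h1 h2.
  have rt : r = t by apply: (P2E _ _ Pr Pt (x - e)); oag R_oag.
  rewrite rt in h1 h2.
  have : y *+ j.+1 <= y *+ k by apply: oag_lerMn; [exact: ltW|case/andP: jk].
  by move=> ?; oag R_oag.
- have [fi _] := fg _ ilt; have [_ gj] := fg _ jlt.
  have [? ?] := P2d _ gj; have [? ?] := yk _ klt.
  have : y *+ k < y *+ k.+1 by rewrite mulrS; oag R_oag.
  move=> ?; exists (f i + g j + y *+ k); split; first by split; oag R_oag.
    by exists (f i); split => //; split; oag R_oag.
  exists (f i + g j); split; first by exists (f i); split=> //; exists (g j).
  by split; oag R_oag.
Qed.

(** The rows prescribe the interval [[u j, v j + d)], the offset from a point of [D], and the set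
    [P] containing that point. The distance [d] between the intervals leaves room for the
    offsets. *)
Lemma disjoint_recurrent (D : set R) (d : R) (P : R -> (nat -> R) -> Prop) :
  0 < d -> separated d D -> dset I D -> defpar P -> (forall x e, P x e -> D x) ->
  ~ (forall n, exists (t : nat -> nat -> R) (u v : nat -> R),
    [/\ forall j k x, (j < k < n)%N -> P x (t j) -> ~ P x (t k),
        forall j k, (j < k < n)%N -> v j + d <= u k &
        forall j k, (j < n)%N -> (k < n)%N ->
          exists x, [/\ P x (t k), u j <= x & x <= v j]]).
Proof.
move=> d0 sD dD dP PD H.
pose Q0 x (e : nat -> R) := e 0%N <= x /\ x < e 1%N.
pose Q1 x (e : nat -> R) := exists r, D r /\ r + e 0%N <= x /\ x < r + e 1%N.
pose Q2 x (e : nat -> R) := exists r,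
  P r (fun i => e i.+2) /\ r + e 0%N <= x /\ x < r + e 1%N.
apply: (@three_rows Q0 Q1 Q2).
- by rewrite /defpar /Q0; drel.
- by rewrite /defpar /Q1; rewrite /dset in dD; drel.
- exact: defpar_row1.
move=> n; have [t [u [v [Pt uv C]]]] := H n.
have [y y0 yd] := oag_exists_fraction n d0.
exists (fun j => scons (u j) (scons (v j + d) (fun=> 0))),
  (fun k => scons (y *+ k) (scons (y *+ k.+1) (fun=> 0))),
  (fun l => scons 0 (scons d (t l))).
have lt_n j k : (j < k < n)%N -> (j < n)%N /\ (k < n)%N.
  by case/andP=> jk kn; split=> //; exact: ltn_trans kn.
have yk k : (k < n)%N -> 0 <= y *+ k /\ y *+ k.+1 <= d.
  move=> kn; split; first exact: (oag_mulrn_ge0 R_oag _ (ltW y0)).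
  by apply: le_trans yd; apply: oag_lerMn => //; exact: ltW.
split=> [j k x jk|j k x jk|j k x jk|i j k ilt jlt klt]; rewrite /Q0 /Q1 /Q2 /=.
- by move=> [h1 h2] [h3 h4]; have := uv _ _ jk => ?; oag R_oag.
- move=> [r [Dr [h1 h2]]] [e [De [h3 h4]]]; have [jn kn] := lt_n _ _ jk.
  have [? ?] := yk _ jn; have [? ?] := yk _ kn.
  have re : r = e by apply: (separated_inj sD Dr De); oag R_oag.
  have : y *+ j.+1 <= y *+ k by apply: oag_lerMn; [exact: ltW|case/andP: jk].
  by move=> ?; oag R_oag.
- move=> [r [Pr [h1 h2]]] [e [Pe [h3 h4]]].
  have re : r = e by apply: (separated_inj sD (PD _ _ Pr) (PD _ _ Pe)); oag R_oag.
  by apply: (Pt j k r) => //; rewrite re.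
- have [x [Px ux xv]] := C _ _ ilt klt; have [? ?] := yk _ jlt.
  have : y *+ j < y *+ j.+1 by rewrite mulrS; oag R_oag.
  move=> ?; exists (x + y *+ j); split; first by split; oag R_oag.
    by exists x; split; [exact: PD Px|split; oag R_oag].
  by exists x; split=> //; split; oag R_oag.
Qed.

End Burden2.

(** * Definable discrete sets *)

Section DiscreteSets.
Variables (R : porderZmodType) (L : language) (I : interpretation L R).
Hypothesis R_oag : divisible_oag R.
Local Notation M := (og_expansion I).
Hypothesis R_complete : definably_complete I.
Hypothesis R_burden : burden_le M 2.
Hypothesis R_pos : exists u : R, 0 < u.
Implicit Types (D X P : set R).

#[local] Hint Resolve defrel_succ_in : definability.

(** Points isolated with a fixed radius [d] form a [d]-separated set, definable uniformly in [d], as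
    [nested_separated] requires. *)
Definition isolated D (d x : R) : Prop :=
  D x /\ forall y, D y -> (x < y -> x + d <= y) /\ (y < x -> y + d <= x).

Lemma discrete_isolated D x : discrete_subset D -> D x ->
  exists2 d, 0 < d & isolated D d x.
Proof.
move=> disD Dx; have [u [v [ux xv uv]]] := disD _ Dx.
pose d := if x - u <= v - x then x - u else v - x.
have dE : d <= x - u /\ d <= v - x.
  rewrite /d; case: ifPn => [//|]; rewrite -(oag_ltNge R_oag) => ?.
  by split=> //; oag R_oag.
exists d; first by rewrite /d; case: ifP => _; oag R_oag.
case: dE => ? ?; split=> // y Dy; split=> xy; rewrite (oag_leNgt R_oag); apply/negP => yx.
  have E : y = x by apply: uv => //; oag R_oag.
  by rewrite E ltxx in xy.
have E : y = x by apply: uv => //; oag R_oag.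
by rewrite E ltxx in xy.
Qed.

Lemma isolated_le D d d' x : d' <= d -> isolated D d x -> isolated D d' x.
Proof.
move=> dd [Dx H]; split=> // y Dy; have [H1 H2] := H _ Dy.
by split=> [/H1|/H2] ?; oag R_oag.
Qed.

Lemma discrete_isolated_seq D (f : nat -> R) n : discrete_subset D ->
  (forall i, (i < n)%N -> D (f i)) ->
  exists2 d, 0 < d & forall i, (i < n)%N -> isolated D d (f i).
Proof.
move=> disD; elim: n => [|n IH] Df; first by have [u u0] := R_pos; exists u.
have [d d0 Hd] := IH (fun i lin => Df _ (ltnW lin)).
have [d' d'0 Hd'] := discrete_isolated disD (Df _ (ltnSn n)).
have [dd|dd] := orP (oag_le_total R_oag d d').
  exists d => // i; rewrite ltnS leq_eqVlt => /predU1P[->|/Hd//].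
  exact: isolated_le Hd'.
exists d' => // i; rewrite ltnS leq_eqVlt => /predU1P[->//|/Hd].
exact: isolated_le.
Qed.

(** If [D] accumulates at [c], points of [D] very close to [c], translated by [- c], fit within the
    isolation radius of [n] other points, against [nested_separated]. *)
Lemma no_right_accumulation D c : dset I D -> discrete_subset D ->
  exists2 eps, 0 < eps & forall x, D x -> c < x -> c + eps <= x.
Proof.
move=> dD disD; apply: contrapT => nacc.
have /choice[g gP] : forall eps, exists x, 0 < eps -> [/\ D x, c < x & x < c + eps].
  move=> eps; apply: contrapT => /forallNP H; apply: nacc; exists eps.
    by apply: contrapT => neps; apply: (H 0).
  move=> x Dx cx; rewrite (oag_leNgt R_oag); apply/negP => xeps.
  by apply: (H x).
have seq_near eps : 0 < eps -> exists f : nat -> R,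
    (forall i, [/\ D (f i), c < f i & f i < c + eps]) /\
    (forall i j, (i < j)%N -> f j < f i).
  move=> eps0; pose f := fix f n := if n is n'.+1 then g (f n' - c) else g eps.
  have fP i : [/\ D (f i), c < f i & f i < c + eps].
    elim: i => [|i [Di ci ieps]] /=; first exact: gP.
    by have [|? ? ?] := gP (f i - c); [oag R_oag|split=> //; oag R_oag].
  have fS i : f i.+1 < f i.
    have [_ ci _] := fP i; have [|_ _ ?] := gP (f i - c); first by oag R_oag.
    by rewrite /=; oag R_oag.
  exists f; split=> // i j; elim: j => // j IH; rewrite ltnS leq_eqVlt => /predU1P[->//|/IH ?].
  by have := fS j => ?; oag R_oag.
apply: (@nested_separated _ _ I R_oag R_burden
  (fun x e => isolated D (e 0%N) x)
  (fun x e => isolated D (e 1%N) (c + x) /\ 0 <= x /\ x + e 1%N <= e 0%N)).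
- by rewrite /defpar /isolated; drel.
- by rewrite /defpar /isolated; drel.
move=> n; have [u u0] := R_pos; have [f [fP fd]] := seq_near u u0.
have [d1 d10 d1P] := @discrete_isolated_seq D f n disD (fun i _ => let: And3 Df _ _ := fP i in Df).
(* The second sequence lies within [h] of [c] and its radius [k] is at most [h], so its translates
   [y] satisfy [y + k <= d1]. *)
have [h h0 hd] := oag_exists_fraction R_oag 2 d10.
have [g' [gP' gd]] := seq_near h h0.
have [d2 d20 d2P] := @discrete_isolated_seq D g' n disD (fun i _ => let: And3 Df _ _ := gP' i in Df).
have [k [k0 [kh kd]]] : exists k, 0 < k /\ k <= h /\ k <= d2.
  by have [?|?] := orP (oag_le_total R_oag h d2); [exists h|exists d2].
exists (scons d1 (scons k (fun=> 0))), d1, k, f, (fun i => g' i - c) => /=.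
split=> //.
- by move=> x y [_ H] [Dy _] xy; have [H1 _] := H _ Dy; exact: H1.
- move=> x y [[_ H] _] [[Dy _] _] xy; have [H1 _] := H _ Dy.
  have : c + x < c + y by oag R_oag.
  by move=> /H1 ?; oag R_oag.
- by move=> y [_ []].
- split=> [i lin|i j /andP[ij _]]; last first.
    have ? := fd _ _ ij; have ? := gd _ _ ij.
    by split=> fij; oag R_oag.
  split; first exact: d1P.
  have [_ ? ?] := gP' i; split; last by split; oag R_oag.
  rewrite addrC subrK; apply: isolated_le (d2P _ lin) => //.
Qed.

Lemma discrete_opp D : discrete_subset D -> discrete_subset (fun x => D (- x)).
Proof.
move=> disD x /disD[u [v [ux xv H]]]; exists (- v), (- u); split; [oag R_oag..|].
move=> y Dy vy yu; apply: oppr_inj; apply: H => //; oag R_oag.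
Qed.

Lemma no_left_accumulation D c : dset I D -> discrete_subset D ->
  exists2 eps, 0 < eps & forall x, D x -> x < c -> x + eps <= c.
Proof.
move=> dD disD.
have [eps eps0 H] := no_right_accumulation (- c) (defrel_opp dD) (discrete_opp disD).
exists eps => // x Dx xc; have : - c + eps <= - x by apply: H; [rewrite opprK|oag R_oag].
by move=> ?; oag R_oag.
Qed.

(** The supremum is not approached from the left, so it is attained. *)
Lemma dset_has_max X : dset I X -> discrete_subset X -> (exists x, X x) ->
  (exists b, forall x, X x -> x <= b) -> exists m, X m /\ forall x, X x -> x <= m.
Proof.
move=> dX disX [x0 Xx0] [b Xb].
have [|||s [sub sle]] := R_complete (A := X).
- exact: (@definable_of_defrel _ M (0 : R) X dX).
- by exists x0.
- by exists b => x /Xb.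
have [eps eps0 H] := no_left_accumulation s dX disX.
have [Xs|nXs] := pselect (X s); first by exists s; split=> // x; exact: sub.
have : s <= s - eps.
  apply: sle => x Xx; have : x + eps <= s.
    apply: H => //; have := sub _ Xx; rewrite le_eqVlt => /predU1P[xs|//].
    by rewrite xs in Xx.
  by move=> ?; oag R_oag.
by move=> ?; oag R_oag.
Qed.

Lemma dset_has_min X : dset I X -> discrete_subset X -> (exists x, X x) ->
  (exists b, forall x, X x -> b <= x) -> exists m, X m /\ forall x, X x -> m <= x.
Proof.
move=> dX disX [x Xx] [b Xb].
have [||m [Xm Hm]] := dset_has_max (defrel_opp dX) (discrete_opp disX).
- by exists (- x); rewrite opprK.
- by exists (- b) => y /Xb ?; oag R_oag.
exists (- m); split=> // y Xy.
have : - y <= m by apply: Hm; rewrite opprK.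
by move=> ?; oag R_oag.
Qed.

Lemma discrete_sub D X : X `<=` D -> discrete_subset D -> discrete_subset X.
Proof.
move=> XD disD x Xx; have [u [v [ux xv H]]] := disD _ (XD _ Xx).
by exists u, v; split=> // y /XD; exact: H.
Qed.

(** * Successors and definable induction *)

Section OneSet.
Variable D : set R.
Hypothesis D_dset : dset I D.
Hypothesis D_disc : discrete_subset D.

Lemma dsub_min X : dset I X -> X `<=` D -> (exists x, X x) ->
  (exists b, forall x, X x -> b <= x) -> exists m, X m /\ forall x, X x -> m <= x.
Proof. by move=> dX XD; apply: dset_has_min => //; exact: discrete_sub D_disc. Qed.

Lemma dsub_max X : dset I X -> X `<=` D -> (exists x, X x) ->
  (exists b, forall x, X x -> x <= b) -> exists m, X m /\ forall x, X x -> x <= m.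
Proof. by move=> dX XD; apply: dset_has_max => //; exact: discrete_sub D_disc. Qed.

Lemma succ_exists x z : D z -> x < z -> exists y, succ_in D x y.
Proof.
move=> Dz xz.
have [||||m [[Dm xm] H]] := @dsub_min (fun y => D y /\ x < y).
- by rewrite /dset; drel.
- by move=> y [].
- by exists z.
- by exists x => y [_ /ltW].
by exists m; split=> // c Dc xc; exact: H.
Qed.

Lemma pred_exists x z : D x -> D z -> z < x -> exists2 y, D y & succ_in D y x.
Proof.
move=> Dx Dz zx.
have [||||m [[Dm mx] H]] := @dsub_max (fun y => D y /\ y < x).
- by rewrite /dset; drel.
- by move=> y [].
- by exists z.
- by exists x => y [_ /ltW].
exists m => //; split=> // c Dc mc; rewrite (oag_leNgt R_oag); apply/negP => cx.
by have := H c (conj Dc cx) => ?; oag R_oag.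
Qed.

(** Stretches of [D] may be infinite, so this is induction for definable properties only: a least
    counterexample above [a] has a predecessor. *)
Lemma discrete_ind (P : set R) a : dset I P -> D a -> P a ->
  (forall x y, D x -> a <= x -> succ_in D x y -> P x -> P y) ->
  forall x, D x -> a <= x -> P x.
Proof.
move=> dP Da Pa Pstep x Dx ax; apply: contrapT => nPx.
have [||||m [[Dm [am nPm]] H]] := @dsub_min (fun y => D y /\ a <= y /\ ~ P y).
- by rewrite /dset; drel.
- by move=> y [].
- by exists x.
- by exists a => y [_ []].
have am' : a < m.
  by move: am; rewrite le_eqVlt => /predU1P[am|//]; rewrite -am in nPm.
have [y Dy ym] := pred_exists Dm Da am'; have [_ ylt Hy] := ym.
have ay : a <= y.
  by rewrite (oag_leNgt R_oag); apply/negP => ya; have := Hy _ Da ya => ?; oag R_oag.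
apply: nPm; apply: Pstep ym _ => //.
by apply: contrapT => nPy; have := H y (conj Dy (conj ay nPy)) => ?; oag R_oag.
Qed.

Lemma succ_in_uniq x y z : succ_in D x y -> succ_in D x z -> y = z.
Proof.
move=> [Dy xy Hy] [Dz xz Hz]; apply: le_anti.
by rewrite (Hy _ Dz xz) (Hz _ Dy xy).
Qed.

(** * Finiteness of the set of gaps *)

Definition gaps : set R := fun g => exists x y, [/\ D x, succ_in D x y & g = y - x].

Definition gaps_between (a z : R) : set R :=
  fun g => exists x y, D x /\ a <= x /\ succ_in D x y /\ y <= z /\ g = y - x.

(** Having a separation radius is a definable property of [z], so [discrete_ind] applies even across
    infinitely many points. Passing to the successor adds at most one gap, [g0]. *)
Lemma gaps_between_separated a z : D a -> D z -> a <= z ->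
  exists d, 0 < d /\ separated d (gaps_between a z).
Proof.
move=> Da; move: z.
apply: (@discrete_ind (fun z => exists d, 0 < d /\ separated d (gaps_between a z))) => //.
- by rewrite /dset /separated /gaps_between; drel.
- have [u u0] := R_pos; exists u; split=> // g h.
  move=> [x [y [_ [ax [[_ xy _] [ya _]]]]]]; exfalso; oag R_oag.
move=> z z' Dz az zz' [d [d0 sep]].
pose g0 := z' - z.
have split_gap g : gaps_between a z' g -> gaps_between a z g \/ g = g0.
  move=> [x [y [Dx [ax [xy [yz' ->]]]]]].
  have [yz|zy] := boolP (y <= z); first by left; exists x, y.
  right; case: (zz') (xy) => Dz' lzz' Hz [Dy lxy Hx].
  rewrite -(oag_ltNge R_oag) in zy.
  have z'y := Hz _ Dy zy.
  have yE : y = z' by oag R_oag.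
  have xz : x = z.
    have [//|lt|lt] := oag_lt_total R_oag x z.
      by have := Hx _ Dz lt => ?; oag R_oag.
    by have := Hz _ Dx lt => ?; oag R_oag.
  by rewrite yE xz.
(* At most one earlier gap lies within [d] below [g0]; if there is one, its distance to [g0] is the
   radius on that side. *)
have [d1 [d10 H1]] : exists d1, 0 < d1 /\ forall g, gaps_between a z g -> g < g0 -> g + d1 <= g0.
  have [[g1 [G1 [lt1 near1]]]|none] := pselect (exists g1, gaps_between a z g1 /\ g1 < g0 /\ g0 < g1 + d).
    exists (g0 - g1); split=> [|g Gg gg0]; first by oag R_oag.
    have [->|lt|lt] := oag_lt_total R_oag g g1; [oag R_oag..|].
    by have := sep _ _ G1 Gg lt => ?; oag R_oag.
  exists d; split=> // g Gg gg0; rewrite (oag_leNgt R_oag); apply/negP => ?.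
  by apply: none; exists g.
have [d2 [d20 H2]] : exists d2, 0 < d2 /\ forall g, gaps_between a z g -> g0 < g -> g0 + d2 <= g.
  have [[g1 [G1 [lt1 near1]]]|none] := pselect (exists g1, gaps_between a z g1 /\ g0 < g1 /\ g1 < g0 + d).
    exists (g1 - g0); split=> [|g Gg gg0]; first by oag R_oag.
    have [->|lt|lt] := oag_lt_total R_oag g g1; [oag R_oag| |oag R_oag].
    by have := sep _ _ Gg G1 lt => ?; oag R_oag.
  exists d; split=> // g Gg gg0; rewrite (oag_leNgt R_oag); apply/negP => ?.
  by apply: none; exists g.
have [d' [d'0 [? [? ?]]]] : exists d', 0 < d' /\ d' <= d /\ d' <= d1 /\ d' <= d2.
  have [?|?] := orP (oag_le_total R_oag d1 d2).
    by have [?|?] := orP (oag_le_total R_oag d d1); [exists d|exists d1]; do ?split=> //; oag R_oag.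
  by have [?|?] := orP (oag_le_total R_oag d d2); [exists d|exists d2]; do ?split=> //; oag R_oag.
exists d'; split=> // g h /split_gap[Gg|->] /split_gap[Gh|->] gh.
- by have := sep _ _ Gg Gh gh => ?; oag R_oag.
- by have := H1 _ Gg gh => ?; oag R_oag.
- by have := H2 _ Gh gh => ?; oag R_oag.
- by rewrite ltxx in gh.
Qed.

Lemma infinite_increasing X n : infinite_set X ->
  exists f : nat -> R, (forall i, (i < n)%N -> X (f i)) /\
    (forall i j, (i < j < n)%N -> f i < f j).
Proof.
move=> infX; have [B BX Bn] := infinite_set_fset n infX.
pose s := sort <=%O (finmap.enum_fset B).
have s_sorted : sorted <=%O s by apply: sort_sorted => x y; exact: oag_le_total.
have sz : (n <= size s)%N by rewrite size_sort.
exists (nth 0 s); split=> [i lin|i j /andP[ij jn]].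
  apply: BX; rewrite /= -(mem_sort <=%O); apply: mem_nth; exact: leq_trans sz.
have js := leq_trans jn sz; have is_ := ltn_trans ij js.
have := sorted_ltn_nth le_trans 0 s_sorted; move=> /(_ i j is_ js ij).
rewrite le_eqVlt => /predU1P[/eqP|//].
have s_uniq : uniq s by rewrite sort_uniq finmap.fset_uniq.
by rewrite nth_uniq// => /eqP eij; rewrite eij ltnn in ij.
Qed.

Lemma lower_in (s : nat -> R) n d : D d -> (forall i, (i < n)%N -> D (s i)) ->
  exists2 a, D a & forall i, (i < n)%N -> a <= s i.
Proof.
move=> Dd; elim: n => [|n IH] Ds; first by exists d.
have [a Da Ha] := IH (fun i lin => Ds _ (ltnW lin)).
have [as_|sa] := orP (oag_le_total R_oag a (s n)).
  by exists a => // i; rewrite ltnS leq_eqVlt => /predU1P[->//|/Ha].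
exists (s n); first exact: Ds.
by move=> i; rewrite ltnS leq_eqVlt => /predU1P[->//|/Ha]; exact: le_trans.
Qed.

Lemma upper_in (s : nat -> R) n d : D d -> (forall i, (i < n)%N -> D (s i)) ->
  exists2 a, D a & forall i, (i < n)%N -> s i <= a.
Proof.
move=> Dd; elim: n => [|n IH] Ds; first by exists d.
have [a Da Ha] := IH (fun i lin => Ds _ (ltnW lin)).
have [as_|sa] := orP (oag_le_total R_oag (s n) a).
  by exists a => // i; rewrite ltnS leq_eqVlt => /predU1P[->//|/Ha].
exists (s n); first exact: Ds.
by move=> i; rewrite ltnS leq_eqVlt => /predU1P[->//|/Ha] /le_trans; exact.
Qed.

(** Take [2n + 1] increasing gaps with middle term [f n]. The points of [D] followed by no smaller
    gap are [f n]-separated, and the gaps well below [f n] are the second set for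
    [nested_separated]. *)
Lemma gaps_finite : finite_set gaps.
Proof.
apply: contrapT => infG.
apply: (@nested_separated _ _ I R_oag R_burden
  (fun x e => D x /\ forall y, D y -> x < y -> x + e 0%N <= y)
  (fun g e => gaps_between (e 2%N) (e 3%N) g /\ 0 <= g /\ g + e 1%N <= e 0%N)).
- by rewrite /defpar; drel.
- by rewrite /defpar /gaps_between; drel.
move=> n; have [f [fG flt]] := infinite_increasing (n + n).+1 infG.
have /choice[x /choice[y xyP]] : forall i, exists x y, (i < (n + n).+1)%N ->
    [/\ D x, succ_in D x y & f i = y - x].
  move=> i; have [/fG[x [y H]]|_] := boolP (i < (n + n).+1)%N; first by exists x, y.
  by exists 0, 0.
(* Separation of gaps is only known between two points of [D], so the chosen gaps are enclosed
   between [a] and [z]. *)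
have [a Da aP] := @lower_in x (n + n).+1 (x 0%N)
  (let: And3 H _ _ := xyP _ (ltn0Sn _) in H) (fun i lin => let: And3 H _ _ := xyP _ lin in H).
have [z Dz zP] := @upper_in y (n + n).+1 (x 0%N)
  (let: And3 H _ _ := xyP _ (ltn0Sn _) in H)
  (fun i lin => let: And3 _ H _ := xyP _ lin in let: And3 H' _ _ := H in H').
have fab i : (i < (n + n).+1)%N -> gaps_between a z (f i).
  move=> lin; have [Dx xy fi] := xyP _ lin.
  by exists (x i), (y i); do !split=> //; [exact: aP|case: xy..|exact: zP].
have f_gt0 i : (i < (n + n).+1)%N -> 0 < f i.
  by move=> lin; have [_ [_ ? _] ?] := xyP _ lin; oag R_oag.
have az : a <= z.
  have l0 := ltn0Sn (n + n); have ? := aP _ l0; have ? := zP _ l0.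
  by have [_ [_ ? _] _] := xyP _ l0; oag R_oag.
have [d [d0 sd]] := gaps_between_separated Da Dz az.
exists (scons (f n) (scons d (scons a (scons z (fun=> 0))))), (f n), d,
  (fun i => x (n + i)%N), f => /=.
have nn : (n < (n + n).+1)%N by rewrite ltnS leq_addr.
split=> //.
- by move=> u v [_ H] [Dv _]; exact: H.
- by move=> g h [Gg _] [Gh _]; exact: sd.
- by move=> g [_ [? ?]].
split=> [i lin|i j /andP[ij jn]].
  have lnin : (n + i < (n + n).+1)%N by rewrite ltnS leq_add2l ltnW.
  have li : (i < (n + n).+1)%N by apply: ltn_trans nn.
  have [Dx [Dy xy Hxy] fE] := xyP _ lnin; split.
    split=> // v Dv xv; have := Hxy _ Dv xv => ?.
    have : f n <= f (n + i)%N.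
      have [->|i0] := posnP i; first by rewrite addn0.
      by apply: ltW; apply: flt; rewrite lnin -{1}(addn0 n) ltn_add2l i0.
    by move=> ?; oag R_oag.
  split; first exact: fab.
  split; first exact: ltW (f_gt0 _ li).
  by apply: sd; [exact: fab..|apply: flt; rewrite lin nn].
split; last by move=> fij; have := flt i j; rewrite ij (ltn_trans jn nn) fij ltxx => /(_ isT).
have lj : (n + j < (n + n).+1)%N by rewrite ltnS leq_add2l ltnW.
have li : (n + i < n + j)%N by rewrite ltn_add2l.
move=> xij; have [_ si fi] := xyP _ (ltn_trans li lj); have [_ sj fj] := xyP _ lj.
have := flt (n + i)%N (n + j)%N; rewrite li lj fi fj xij.
by rewrite -xij (succ_in_uniq si (eq_ind_r (fun w => succ_in D w _) sj xij)) ltxx => /(_ isT).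
Qed.

Lemma dset_separated : exists2 d, 0 < d & separated d D.
Proof.
have /finite_seqP[s sE] := gaps_finite.
have [d d0 dP] : exists2 d, 0 < d & forall g, g \in s -> 0 < g -> d <= g.
  elim: s {sE} => [|h s [d d0 IH]]; first by have [u u0] := R_pos; exists u.
  have [hd|hd] := pselect (0 < h /\ h <= d).
    exists h; first by case: hd.
    move=> g; rewrite inE => /predU1P[-> //|gs g0].
    by apply: le_trans (IH _ gs g0); case: hd.
  exists d => // g; rewrite inE => /predU1P[->|]; last exact: IH.
  move=> h0; rewrite (oag_leNgt R_oag); apply/negP => lt.
  by apply: hd; split=> //; exact: ltW.
exists d => // x y Dx Dy xy; have [w xw] := succ_exists Dy xy.
have [Dw lxw Hw] := xw; have wy := Hw _ Dy xy.
have : d <= w - x.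
  apply: dP; last by oag R_oag.
  by have : gaps (w - x) by [exists x, w]; rewrite sE.
by move=> ?; oag R_oag.
Qed.

End OneSet.
End DiscreteSets.

(** * Words of successive gaps *)

Fixpoint all_words (T : Type) (s : seq T) (n : nat) : seq (seq T) :=
  if n is n'.+1 then [seq x :: w | x <- s, w <- all_words s n'] else [:: [::]].

Lemma mem_all_words (T : eqType) (s : seq T) w :
  all (mem s) w -> w \in all_words s (size w).
Proof.
elim: w => [|x w IH] //= /andP[xs /IH ws].
by apply/allpairsP; exists (x, w).
Qed.

Lemma pigeonhole (T : eqType) (s : seq T) (f : nat -> T) n (l : seq nat) :
  (forall j, j \in l -> f j \in s) -> (size s * n < size l)%N ->
  exists v, (n < size [seq j <- l | f j == v])%N.
Proof.
elim: s l => [|v s IH] l fl.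
  by case: l fl => [//|j l] /(_ j); rewrite mem_head => /(_ isT).
rewrite /= mulSn => szl.
have [?|small] := ltnP n (size [seq j <- l | f j == v]); first by exists v.
have [j||w nw] := IH [seq j <- l | f j != v].
- by rewrite mem_filter => /andP[/negPf fjv /fl]; rewrite inE fjv.
- move: szl small; rewrite !size_filter -(count_predC (fun j => f j == v) l).
  move=> szl small; rewrite -(ltn_add2l n); apply: leq_trans szl _.
  by rewrite leq_add2r.
- exists w; apply: leq_trans nw _; rewrite -filter_predI !size_filter.
  by apply: sub_count => j /= /andP[].
Qed.

(** For definable discrete [C], a progression of difference [d], possibly of nonstandard length. *)
Definition single_gap (R : porderZmodType) (d : R) (C : set R) : Prop :=
  forall x y, C x -> succ_in C x y -> y = x + d.

Lemma uniq_map_inj (T U : eqType) (f : T -> U) (s : seq T) x y :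
  uniq (map f s) -> x \in s -> y \in s -> f x = f y -> x = y.
Proof.
elim: s => //= z s IH /andP[nz us]; rewrite !inE.
move=> /predU1P[->|xs] /predU1P[->|ys] // e; last exact: IH.
- by move: nz; rewrite e map_f.
- by move: nz; rewrite -e map_f.
Qed.

Section Words.
Variables (R : porderZmodType) (L : language) (I : interpretation L R).
Hypothesis R_oag : divisible_oag R.
Local Notation M := (og_expansion I).
Hypothesis R_complete : definably_complete I.
Hypothesis R_burden : burden_le M 2.
Hypothesis R_pos : exists u : R, 0 < u.
Variable D : set R.
Hypothesis D_dset : dset I D.
Hypothesis D_disc : discrete_subset D.

#[local] Hint Resolve defrel_succ_in : definability.

(** The successor in [D], extended by the identity where there is none. *)
Definition next (x : R) : R :=
  if pselect (exists y, succ_in D x y) is left H then sval (cid H) else x.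

Definition gap (x : R) : R := next x - x.

Fixpoint word (k : nat) (x : R) : seq R :=
  if k is k'.+1 then gap x :: word k' (next x) else [::].

Definition same_word k x y : Prop := word k x = word k y.

Definition has_word (w : seq R) x : Prop := word (size w) x = w.

Lemma next_succ x y : succ_in D x y -> next x = y.
Proof.
move=> xy; rewrite /next; case: pselect => [H|[]]; last by exists y.
by case: cid => z /= xz; exact: succ_in_uniq xz xy.
Qed.

Lemma next_id x : ~ (exists y, succ_in D x y) -> next x = x.
Proof. by rewrite /next; case: pselect. Qed.

Lemma succ_next x z : D z -> x < z -> succ_in D x (next x).
Proof.
move=> Dz xz; have [y xy] := succ_exists R_oag R_complete R_burden R_pos D_dset D_disc Dz xz.
by rewrite (next_succ xy).
Qed.

Lemma next_le x z : D z -> x < z -> next x <= z.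
Proof. by move=> Dz xz; have [_ _ H] := succ_next Dz xz; exact: H. Qed.

Lemma D_next x : D x -> D (next x).
Proof.
move=> Dx; have [[y xy]|nx] := pselect (exists y, succ_in D x y).
  by rewrite (next_succ xy); case: xy.
by rewrite next_id.
Qed.

Lemma le_next x : x <= next x.
Proof.
have [[y xy]|nx] := pselect (exists y, succ_in D x y).
  by rewrite (next_succ xy); case: xy => _ /ltW.
by rewrite next_id.
Qed.

Lemma le_iter_next k x : x <= iter k next x.
Proof. by elim: k => //= k IH; exact: le_trans IH (le_next _). Qed.

Lemma gap_ge0 x : 0 <= gap x.
Proof. by have := le_next x => ?; rewrite /gap; oag R_oag. Qed.

Lemma gap_eq0 x z : gap x = 0 -> D z -> z <= x.
Proof.
move=> g0 Dz; rewrite (oag_leNgt R_oag); apply/negP => xz.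
by have [_ + _] := succ_next Dz xz; move: g0; rewrite /gap => ? ?; oag R_oag.
Qed.

Lemma gap_between x u : 0 < u -> u < gap x -> ~ D (x + u).
Proof.
move=> u0 ug Dxu; rewrite /gap in ug.
have xu : x < x + u by oag R_oag.
by have := next_le Dxu xu => ?; oag R_oag.
Qed.

Lemma gap_finite : exists s : seq R, forall x, D x -> gap x \in s.
Proof.
have /finite_seqP[s sE] := gaps_finite R_oag R_complete R_burden R_pos D_dset D_disc.
exists (0 :: s) => x Dx; rewrite inE.
have [[y xy]|nx] := pselect (exists y, succ_in D x y); last first.
  by rewrite /gap next_id// subrr eqxx.
have : gaps D (gap x) by exists x, y; rewrite /gap (next_succ xy).
by rewrite sE => /= ->; rewrite orbT.
Qed.

Lemma defrel_next : @defrel _ M (fun e => next (e 1%N) = e 0%N).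
Proof.
apply: (@defrel_ext _ M (fun e => succ_in D (e 1%N) (e 0%N) \/
  ~ (exists y, succ_in D (e 1%N) y) /\ e 1%N = e 0%N)); last by drel.
move=> e; split=> [[/next_succ//|[/next_id -> //]]|].
have [[y xy]|nx] := pselect (exists y, succ_in D (e 1%N) y); last first.
  by rewrite next_id//; right.
by rewrite (next_succ xy) => <-; left.
Qed.

Lemma defrel_gap : @defrel _ M (fun e => gap (e 1%N) = e 0%N).
Proof. by have := defrel_next => dnext; rewrite /gap; drel. Qed.

#[local] Hint Resolve defrel_next defrel_gap : definability.

Lemma defrel_same_word k : @defrel _ M (fun e => same_word k (e 0%N) (e 1%N)).
Proof.
elim: k => [|k IH]; first exact: (@defrel_cst _ M ([::] = [::] :> seq R)).
apply: (@defrel_ext _ M (fun e => gap (e 0%N) = gap (e 1%N) /\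
  same_word k (next (e 0%N)) (next (e 1%N)))); last by drel.
by move=> e; rewrite /same_word /=; split=> [[-> ->]|[]].
Qed.

Lemma defrel_has_word w : @defrel _ M (fun e => has_word w (e 0%N)).
Proof.
elim: w => [|g w IH]; first exact: (@defrel_cst _ M ([::] = [::] :> seq R)).
apply: (@defrel_ext _ M (fun e => gap (e 0%N) = g /\ has_word w (next (e 0%N)))).
  by move=> e; rewrite /has_word /=; split=> [[-> ->]|[]].
by drel.
Qed.

#[local] Hint Resolve defrel_same_word defrel_has_word : definability.

(** * Words and windows of [D] *)

Lemma size_word k x : size (word k x) = k.
Proof. by elim: k x => //= k IH x; rewrite IH. Qed.

Lemma take_word k x : take k (word k.+1 x) = word k x.
Proof. by elim: k x => // k IH x; exact: (congr1 (cons (gap x)) (IH (next x))). Qed.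

(** The letter [0] marks the last point of [D], and the preceding letters give the distance to
    it. *)
Lemma word_zero k x y : D x -> D y -> word k x = word k y -> 0 \in word k x -> x = y.
Proof.
elim: k x y => // k IH x y Dx Dy [gxy wxy]; rewrite inE => /predU1P[/esym g0|w0].
  apply: le_anti; rewrite (gap_eq0 g0 Dy) andbT.
  by apply: gap_eq0 Dx; rewrite -gxy.
have nxy := IH _ _ (D_next Dx) (D_next Dy) wxy w0.
by move: gxy; rewrite /gap nxy => ?; oag R_oag.
Qed.

(** With [window_word], this turns equality of words into agreement of [D] on a window. The window
    condition is one formula for all lengths [k], as [not_crowded] needs because [k] varies with [n]
    there. *)
Lemma word_window k x a : D x -> D a -> word k x = word k a -> 0 \notin word k a ->
  forall u, 0 <= u -> u <= iter k next a - a -> (D (x + u) <-> D (a + u)).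
Proof.
elim: k x a => [|k IH] x a Dx Da.
  move=> _ _ u u0 /= ua; have -> : u = 0 by oag R_oag.
  by rewrite !addr0.
move=> [gxa wxa]; rewrite inE negb_or => /andP[/eqP g0 w0] u u0.
rewrite iterSr => ua.
have ga0 : gap a <> 0 by move/esym.
have gx0 : gap x <> 0 by rewrite gxa.
have [->|um|up] := oag_lt_total R_oag u 0; [by rewrite !addr0|by oag R_oag|].
have [ug|gu] := boolP (u < gap a).
  have nx : ~ D (x + u) by apply: gap_between; rewrite ?gxa.
  by have na := gap_between up ug; split.
rewrite -(oag_leNgt R_oag) in gu.
have := IH _ _ (D_next Dx) (D_next Da) wxa w0 (u - gap a).
have -> : next x + (u - gap a) = x + u by rewrite -gxa /gap; oag R_oag.
have -> : next a + (u - gap a) = a + u by rewrite /gap; oag R_oag.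
by apply; rewrite /gap in gu *; oag R_oag.
Qed.

Lemma window_word k x a : D x -> D a -> 0 \notin word k a ->
  (forall u, 0 <= u -> u <= iter k next a - a -> (D (x + u) <-> D (a + u))) ->
  word k x = word k a.
Proof.
elim: k x a => // k IH x a Dx Da; rewrite inE negb_or => /andP[/eqP g0 w0].
rewrite iterSr => win.
have ga := gap_ge0 a; have le_it := le_iter_next k (next a).
have gpos : 0 < gap a.
  by move: ga; rewrite le_eqVlt => /predU1P[|//] /g0.
have gE : next a = a + gap a by rewrite /gap; oag R_oag.
have Dxg : D (x + gap a).
  apply/win; [exact: ga|rewrite gE in le_it *; oag R_oag|].
  by rewrite -gE; exact: D_next.
have nxE : next x = x + gap a.
  apply: next_succ; split=> //; first by oag R_oag.
  move=> c Dc xc; rewrite (oag_leNgt R_oag); apply/negP => cx.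
  have : D (a + (c - x)).
    by apply/win; rewrite ?gE in le_it *; [oag R_oag..|rewrite addrC subrK].
  by apply: gap_between; oag R_oag.
have gxa : gap x = gap a by rewrite /gap nxE; rewrite /gap; oag R_oag.
rewrite /= gxa; congr cons; apply: IH => //; [exact: D_next..|].
move=> u u0 ua; rewrite nxE gE -!addrA; apply: win; first by oag R_oag.
by rewrite gE in ua *; oag R_oag.
Qed.

(** The length [k] is existentially quantified, so no bound on it in terms of [n] is assumed. *)
Definition crowded (n : nat) : Prop :=
  exists (k : nat) (a u v : nat -> R),
    [/\ forall i, (i < n)%N -> D (a i) /\ D (u i) /\ D (v i),
        forall i j, (i < j < n)%N -> word k (a i) <> word k (a j) /\ v i < u j &
        forall i j, (i < n)%N -> (j < n)%N ->
          exists x, [/\ D x, u j <= x, x <= v j & word k x = word k (a i)]].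

(** Distinct words have disjoint sets of occurrences, and each set meets all the intervals, against
    [disjoint_recurrent]. *)
Lemma not_crowded : exists n, ~ crowded n.
Proof.
apply/existsNP => all_crowded.
have [d d0 sD] := dset_separated R_oag R_complete R_burden R_pos D_dset D_disc.
apply: (@disjoint_recurrent _ _ I R_oag R_burden D d
  (fun x e => D x /\ forall t, 0 <= t -> t <= e 1%N - e 0%N ->
    (D (x + t) <-> D (e 0%N + t))) d0 sD D_dset).
- by rewrite /defpar; drel.
- by move=> x e [].
(* With [n.+2] there are always two disjoint intervals; a word occurring in both has no letter [0],
   by [word_zero]. *)
move=> n; have [k [a [u [v [Dauv sep vis]]]]] := all_crowded n.+2.
have lt2 i : (i < n)%N -> (i < n.+2)%N by move=> lin; exact: ltn_trans lin (ltnW _).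
have nz i : (i < n.+2)%N -> 0 \notin word k (a i).
  move=> lin; apply/negP => w0.
  have [x [Dx _ xv wx]] := vis i 0%N lin isT.
  have [y [Dy uy _ wy]] := vis i 1%N lin isT.
  have [_ vu] := sep 0%N 1%N isT.
  have xy : x = y by apply: (@word_zero k); rewrite ?wx.
  by oag R_oag.
exists (fun i => scons (a i) (scons (iter k next (a i)) (fun=> 0))), u, v.
split=> [i j x /andP[ij jn] /= [Dx wx] [_ wx']|i j /andP[ij jn]|i j lin ljn].
- have li := lt2 _ (ltn_trans ij jn); have lj := lt2 _ jn.
  have [+ _] := sep i j ltac:(by rewrite ij lj); apply.
  have [Di _] := Dauv _ li; have [Dj _] := Dauv _ lj.
  by rewrite -(window_word Dx Di (nz _ li) wx) (window_word Dx Dj (nz _ lj) wx').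
- have lj := lt2 _ jn; have li := ltn_trans ij lj.
  have [_ vu] := sep i j ltac:(by rewrite ij lj).
  by have [_ [Du _]] := Dauv _ lj; have [_ [_ Dv]] := Dauv _ li; exact: sD.
- have [x [Dx ux xv wx]] := vis j i (lt2 _ ljn) (lt2 _ lin).
  exists x; split=> //=; split=> // t t0 ta.
  have [Da _] := Dauv _ (lt2 _ ljn).
  exact: (word_window Dx Da wx (nz _ (lt2 _ ljn))).
Qed.

(** * Deterministic and bad pieces *)

Definition deterministic (k : nat) (J : set R) : Prop :=
  forall x y, J x -> J y -> word k x = word k y -> word k.+1 x = word k.+1 y.

(** A finite conjunction over [k], hence definable in the endpoints of [J]; this gives a least bad
    endpoint in [bad_chain_cover]. *)
Definition bad (n : nat) (J : set R) : Prop :=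
  forall k, (k < n)%N -> exists x y, (J x /\ J y) /\
    same_word k x y /\ ~ same_word k.+1 x y.

Lemma not_bad n J : ~ bad n J -> exists2 k, (k < n)%N & deterministic k J.
Proof.
move=> /existsNP[k /not_implyP[kn H]]; exists k => // x y Jx Jy wxy.
by apply: contrapT => nwxy; apply: H; exists x, y.
Qed.

(** The Morse-Hedlund argument: at every length where the next letter is not
    determined by the word, a new word appears. *)
Lemma bad_words n J x0 : J x0 -> bad n J ->
  exists s : seq R, [/\ size s = n.+1, {in s, forall x, J x} & uniq (map (word n) s)].
Proof.
move=> Jx0; elim: n => [_|n IH badJ].
  by exists [:: x0]; split=> // x; rewrite inE => /eqP ->.
have [k kn|s [szs sJ us]] := IH; first by apply: badJ; exact: ltnW.
have [x [y [[Jx Jy] [wxy nwxy]]]] := badJ n (ltnSn n).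
(* The points of [s] are told apart by their words of length [n], so the words of length [n.+1] of
   [x] and [y] cannot both occur in [s]. *)
have [w Jw nw] : exists2 w, J w & word n.+1 w \notin map (word n.+1) s.
  have [/mapP[x' x's ex]|] := boolP (word n.+1 x \in map (word n.+1) s); last by exists x.
  have [/mapP[y' y's ey]|] := boolP (word n.+1 y \in map (word n.+1) s); last by exists y.
  case: nwxy; rewrite /same_word ex ey; congr word.
  apply: (uniq_map_inj us x's y's).
  by rewrite -(take_word n x') -(take_word n y') -ex -ey !take_word wxy.
exists (w :: s); split=> /=; first by rewrite szs.
  by move=> z; rewrite inE => /predU1P[->|/sJ].
rewrite nw /=; apply: (@map_uniq _ _ (take n)); rewrite -map_comp.
by rewrite (eq_map (take_word n)).
Qed.

Definition bad_chain (n m : nat) (a : R) : Prop :=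
  exists u v : nat -> R,
    (forall j, (j < m)%N -> [/\ D (u j), D (v j), a <= u j, u j <= v j &
      bad n (fun x => D x /\ u j <= x /\ x <= v j)]) /\
    (forall i j, (i < j < m)%N -> v i < u j).

(** Each bad interval shows [n.+1] distinct words of length [n] over a finite alphabet. In a long
    chain, more than [n] intervals show the same list of words, which is crowding. *)
Lemma bad_chain_bounded n : ~ crowded n -> exists m, forall a, ~ bad_chain n m a.
Proof.
move=> ncr; have [g gP] := gap_finite.
have word_in k x : D x -> word k x \in all_words g k.
  rewrite -{2}(size_word k x) => Dx; apply: mem_all_words.
  elim: k x Dx => //= k IH x Dx; rewrite IH ?andbT; last exact: D_next.
  exact: gP.
(* The possible lists of [n.+1] words of length [n]. *)
pose S := all_words (all_words g n) n.+1.
exists (size S * n).+1 => a [u [v [uvP uv]]]; apply: ncr.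
set m := (size S * n).+1 in uvP uv.
have /choice[s sP] : forall j, exists s : seq R, (j < m)%N ->
    [/\ size s = n.+1, {in s, forall x, D x /\ u j <= x /\ x <= v j}
      & uniq (map (word n) s)].
  move=> j; have [jm|_] := boolP (j < m)%N; last by exists [::].
  have [Du Dv _ uvj bj] := uvP _ jm.
  by have [|s sP] := @bad_words n _ (u j) _ bj; [|exists s].
have [|//|V nV] := @pigeonhole _ S (fun j => map (word n) (s j)) n (iota 0 m).
- move=> j; rewrite mem_iota add0n => /= jm; have [szs sJ _] := sP _ jm.
  rewrite /S -szs -(size_map (word n) (s j)); apply: mem_all_words.
  by apply/allP => _ /mapP[x /sJ[Dx _] ->]; exact: word_in.
- by rewrite size_iota.
set l := [seq j <- _ | _] in nV.
have l_sorted : sorted ltn l by apply: (sorted_filter ltn_trans); exact: iota_ltn_sorted.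
have lP i : (i < n)%N -> (nth 0 l i < m)%N /\ map (word n) (s (nth 0 l i)) = V.
  move=> lin; have : nth 0%N l i \in l by apply: mem_nth; exact: ltn_trans nV.
  by rewrite mem_filter mem_iota add0n => /andP[/eqP -> /= ->].
have [n0|n_gt0] := posnP n.
  by exists 0%N, (fun=> 0), (fun=> 0), (fun=> 0); rewrite n0; split=> // i j /andP[].
have [j0m V0] := lP 0%N n_gt0.
have [sz0 J0 u0] := sP _ j0m.
exists n, (nth 0 (s (nth 0%N l 0))), (fun j => u (nth 0%N l j)), (fun j => v (nth 0%N l j)).
split.
- move=> i lin; have [jm _] := lP _ lin; have [Du Dv _ _ _] := uvP _ jm.
  have [|//] := J0 (nth 0 (s (nth 0%N l 0)) i).
  by apply: mem_nth; rewrite sz0 ltnS ltnW.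
- move=> i j /andP[ij jn]; have lin := ltn_trans ij jn; split.
    rewrite -!(nth_map 0 [::] (word n)) ?sz0 1?ltnS 1?ltnW// => /eqP.
    rewrite nth_uniq ?size_map ?sz0 1?ltnS 1?ltnW// => /eqP ij0.
    by rewrite ij0 ltnn in ij.
  have [jm _] := lP _ jn; apply: uv; rewrite jm andbT.
  apply: (sorted_ltn_nth ltn_trans) => //; rewrite inE; exact: ltn_trans nV.
- move=> i j lin jn; have [jm Vj] := lP _ jn; have [szj Jj _] := sP _ jm.
  exists (nth 0 (s (nth 0%N l j)) i).
  have [|Dx [ux xv]] := Jj (nth 0 (s (nth 0%N l j)) i).
    by apply: mem_nth; rewrite szj ltnS ltnW.
  by split=> //; rewrite -!(nth_map 0 [::] (word n)) ?szj ?sz0 1?ltnS 1?ltnW// Vj V0.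
Qed.

(** Compare the steps to the next occurrence of [w] from [x] and from [y], the first being the
    shorter. Determinism carries the points of [D] after [x], with their words, to points after [y];
    so [w] recurs after [y] at the same distance. *)
Lemma deterministic_single_gap k (J : set R) w : dset I J -> J `<=` D ->
  (forall x y z, J x -> J z -> D y -> x <= y -> y <= z -> J y) ->
  deterministic k J -> size w = k ->
  exists2 d, 0 < d & single_gap d (fun x => J x /\ has_word w x).
Proof.
move=> dJ JD convJ detJ szw; pose C x := J x /\ has_word w x; rewrite -/C.
have le_gap x y x' y' : C x -> C y -> succ_in C x x' -> succ_in C y y' ->
    x' - x <= y' - y -> y' <= x' - x + y.
  move=> [Jx wx] [Jy wy] [[Jx' wx'] xx' Hx] [[Jy' wy'] yy' Hy] le.
  have [Dx Dx'] := (JD _ Jx, JD _ Jx').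
  have H : forall z, D z -> x <= z ->
      (z <= x' -> D (z - x + y) /\ same_word k z (z - x + y)).
    apply: (discrete_ind R_oag R_complete R_burden R_pos D_dset D_disc
      (P := fun z => z <= x' -> D (z - x + y) /\ same_word k z (z - x + y))) => //.
    - by rewrite /dset; drel.
    - by move=> _; rewrite subrr add0r /same_word -szw wx wy; split=> //; exact: JD.
    move=> z z' Dz xz zz' IH z'x'; have [Dz' lzz' _] := zz'.
    have [|Dt wt] := IH; first by oag R_oag.
    have Jz : J z by apply: (convJ x z x') => //; oag R_oag.
    have Jt : J (z - x + y) by apply: (convJ y _ y') => //; oag R_oag.
    have [gE nE] := detJ _ _ Jz Jt wt.
    have nz : next z = z' by exact: next_succ.
    have ntE : next (z - x + y) = z' - x + y.
      by move: gE; rewrite /gap nz => ?; oag R_oag.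
    rewrite -ntE; split; first exact: D_next.
    by move: nE; rewrite nz /same_word.
  have [|Dt wt] := H _ Dx' (ltW xx') _; first by [].
  apply: Hy; last by oag R_oag.
  split; first by apply: (convJ y _ y') => //; oag R_oag.
  by rewrite /has_word szw -wt -szw.
have [[x [x' [Cx xx']]]|none] := pselect (exists x x', C x /\ succ_in C x x'); last first.
  (* If no occurrence has a successor, any positive difference works. *)
  by have [u u0] := R_pos; exists u => // x y Cx xy; case: none; exists x, y.
exists (x' - x); first by case: xx' => _ ? _; oag R_oag.
move=> y y' Cy yy'; have [le|le] := orP (oag_le_total R_oag (x' - x) (y' - y)).
  by have := le_gap _ _ _ _ Cx Cy xx' yy' le => ?; oag R_oag.
by have := le_gap _ _ _ _ Cy Cx yy' xx' le => ?; oag R_oag.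
Qed.

(** * Covering by progressions *)

Section Covering.
(** An abstract class closed under finite unions replaces explicit lists of progressions; it is
    later instantiated with [ladder_def]. *)
Variable Q : set R -> Prop.
Hypothesis Q0 : Q set0.
Hypothesis QU : forall A B, Q A -> Q B -> Q (fun x => A x \/ B x).
Hypothesis Q_single : forall C d, dset I C -> C `<=` D ->
  (exists b, forall x, C x -> b <= x) -> 0 < d -> single_gap d C -> Q C.

(** [J] is the finite union, over the words of length [k] in the alphabet of gaps, of their sets of
    occurrences. *)
Lemma Q_deterministic k (J : set R) : dset I J -> J `<=` D ->
  (exists b, forall x, J x -> b <= x) ->
  (forall x y z, J x -> J z -> D y -> x <= y -> y <= z -> J y) ->
  deterministic k J -> Q J.
Proof.
move=> dJ JD [b Jb] convJ detJ; have [g gP] := gap_finite.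
have QW (W : seq (seq R)) : {in W, forall w, size w = k} ->
    Q (fun x => J x /\ word k x \in W).
  elim: W => [|w W IH] szW.
    by rewrite (_ : (fun x => _) = set0)//; apply/seteqP; split=> x [].
  rewrite (_ : (fun x => _) = (fun x => (J x /\ has_word w x) \/ (J x /\ word k x \in W))).
    apply: QU; last by apply: IH => v vW; apply: szW; rewrite inE vW orbT.
    have szw : size w = k by apply: szW; rewrite mem_head.
    have [d d0 dC] := deterministic_single_gap dJ JD convJ detJ szw.
    apply: (Q_single (d := d)) => //.
    - by rewrite /dset; rewrite /dset in dJ; drel.
    - by move=> x [/JD].
    - by exists b => x [/Jb].
  have szw : size w = k by apply: szW; rewrite mem_head.
  apply/seteqP; split=> x; rewrite inE /has_word szw.
    by move=> [Jx /predU1P[->|wW]]; [left|right].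
  by move=> [[Jx ->]|[Jx ->]]; rewrite ?eqxx ?orbT.
rewrite (_ : J = (fun x => J x /\ word k x \in all_words g k)).
  apply: QW => w; elim: (k) w => [|n IH] w /=; first by rewrite inE => /eqP ->.
  by move=> /allpairsP[[x v] /= [_ /IH <- ->]].
apply/seteqP; split=> x; last by case.
move=> Jx; split=> //; rewrite -{2}(size_word k x); apply: mem_all_words.
move: (JD _ Jx) => {Jx}; elim: (k) x => //= n IH x Dx; rewrite IH ?andbT; last exact: D_next.
exact: gP.
Qed.

(** Badness is witnessed by finitely many points. *)
Lemma bad_bounded n (J : set R) x0 : J x0 -> bad n J ->
  exists2 b, J b & bad n (fun x => J x /\ x <= b).
Proof.
move=> Jx0 badJ.
have /choice[x /choice[y xyP]] : forall k, exists x y, (k < n)%N ->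
    (J x /\ J y) /\ same_word k x y /\ ~ same_word k.+1 x y.
  move=> k; have [/badJ[x [y H]]|_] := boolP (k < n)%N; first by exists x, y.
  by exists 0, 0.
have [b Jb xb] := @upper_in _ R_oag J x n x0 Jx0 (fun k kn => (xyP k kn).1.1).
have [c Jc yc] := @upper_in _ R_oag J y n b Jb (fun k kn => (xyP k kn).1.2).
have [bc|cb] := orP (oag_le_total R_oag b c).
  exists c => // k kn; have [[Jx Jy] H] := xyP k kn; exists (x k), (y k); split=> //.
  by split; split=> //; [exact: le_trans (xb _ kn) bc|exact: yc].
exists b => // k kn; have [[Jx Jy] H] := xyP k kn; exists (x k), (y k); split=> //.
by split; split=> //; [exact: xb|exact: le_trans (yc _ kn) cb].
Qed.

Lemma bad_sub n (J K : set R) : J `<=` K -> bad n J -> bad n K.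
Proof.
by move=> JK badJ k /badJ[x [y [[Jx Jy] H]]]; exists x, y; do !split=> //; exact: JK.
Qed.

(** Cut at the least [b] for which the piece from [a] to [b] is bad. Without [b] the piece is empty
    or deterministic by minimality, and the rest, from [next b], has no bad chain of length [m],
    since prepending the cut piece would give one of length [m.+1]. *)
Lemma bad_chain_cover n m a : D a -> ~ bad_chain n m a -> Q (fun x => D x /\ a <= x).
Proof.
elim: m a => [|m IH] a Da nchain.
  by case: nchain; exists (fun=> 0), (fun=> 0); split=> // i j /andP[].
pose above x := D x /\ a <= x.
have d_above : dset I above by rewrite /dset /above; drel.
have conv_above x y z : above x -> above z -> D y -> x <= y -> y <= z -> above y.
  by move=> [_ ax] _ Dy xy _; split=> //; exact: le_trans xy.
have [bad_above|/not_bad[k _ det]] := pselect (bad n above); last first.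
  by apply: Q_deterministic conv_above det => //; [move=> x []|exists a => x []].
pose B b := D b /\ a <= b /\ bad n (fun x => D x /\ a <= x /\ x <= b).
have [||||b [[Db [ab bad_b]] b_min]] :=
    dsub_min R_oag R_complete R_burden R_pos D_disc (X := B).
- by rewrite /dset /B /bad; drel.
- by move=> x [].
- have [b [Db ab] bad_b] := @bad_bounded n above a (conj Da (lexx a)) bad_above.
  by exists b; split=> //; split=> //; apply: bad_sub bad_b => x [[]].
- by exists a => x [_ []].
pose J0 x := D x /\ a <= x /\ x < b.
have QJ0 : Q J0.
  have [bad0|/not_bad[k _ det]] := pselect (bad n J0).
    have [[x0 Jx0]|noJ] := pselect (exists x0, J0 x0); last first.
      rewrite (_ : J0 = set0)//.
      by apply/seteqP; split=> // x Jx; case: noJ; exists x.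
    have [c [Dc [ac cb]] bad_c] := bad_bounded Jx0 bad0.
    have : b <= c.
      apply: b_min; split=> //; split=> //; apply: bad_sub bad_c => x [[Dx [ax _]] xc].
      by [].
    by move=> ?; exfalso; oag R_oag.
  apply: Q_deterministic det.
  - by rewrite /dset /J0; drel.
  - by move=> x [].
  - by exists a => x [_ []].
  - move=> x y z [_ [ax _]] [_ [_ zb]] Dy xy yz; split=> //.
    by split; [exact: le_trans xy|exact: le_lt_trans zb].
have Qb : Q (fun x => x = b).
  (* A single point has no successor in itself, so any positive difference will do. *)
  have [u u0] := R_pos; apply: (Q_single (d := u)) => //.
  - by rewrite /dset; drel.
  - by move=> x ->.
  - by exists b => x ->.
  - by move=> x y -> [-> ]; rewrite ltxx.
have QJ0b := QU QJ0 Qb.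
have [[z [Dz bz]]|nz] := pselect (exists z, D z /\ b < z); last first.
  rewrite (_ : (fun x => _) = (fun x => J0 x \/ x = b))//.
  apply/seteqP; split=> x; last by move=> [[? []]|->].
  move=> [Dx ax]; have [->|xb|bx] := oag_lt_total R_oag x b; [by right|by left|].
  by case: nz; exists x.
have [Dn bn Hn] := succ_next Dz bz.
have := QU QJ0b (IH _ Dn _).
rewrite (_ : (fun x => _ \/ _) = (fun x => D x /\ a <= x)); last first.
  apply/seteqP; split=> x.
    by move=> [[[? []]|->]|[Dx nx]] //; split=> //; oag R_oag.
  move=> [Dx ax]; have [->|xb|bx] := oag_lt_total R_oag x b.
  - by left; right.
  - by left; left.
  - by right; split=> //; exact: Hn.
apply=> -[u [v [uvP uv]]]; apply: nchain.
exists (fun j => if j is j'.+1 then u j' else a), (fun j => if j is j'.+1 then v j' else b).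
split=> [[|j] jm|[|i] [|j] //].
- by split.
- have [Du Dv nu uvj bj] := uvP j jm; split=> //; oag R_oag.
- move=> jm; have [_ _ nu _ _] := uvP j jm; oag R_oag.
- by move=> ij; apply: uv.
Qed.

Lemma above_cover a : D a -> Q (fun x => D x /\ a <= x).
Proof.
move=> Da; have [n /bad_chain_bounded[m H]] := not_crowded.
exact: bad_chain_cover (H a).
Qed.

End Covering.
End Words.

(** * Ladders *)

Section Ladders.
Variables (R : porderZmodType) (L : language) (I : interpretation L R).
Hypothesis R_oag : divisible_oag R.
Local Notation M := (og_expansion I).
Hypothesis R_complete : definably_complete I.
Hypothesis R_burden : burden_le M 2.
Hypothesis R_pos : exists u : R, 0 < u.
Implicit Types (d : R) (T X : set R).

(** Progressions [0, d, 2d, ...] containing all standard multiples of [d], bounded or not. *)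
Record ladder d T : Prop := Ladder {
  ladder_dset : dset I T;
  ladder_discrete : discrete_subset T;
  ladder_pos : 0 < d;
  ladder_gap : single_gap d T;
  ladder0 : T 0;
  ladder_ge0 : forall x, T x -> 0 <= x;
  ladder_infinite : infinite_set T }.

Lemma oag_ltrMn (x : R) (m n : nat) : 0 < x -> (m < n)%N -> x *+ m < x *+ n.
Proof.
move=> x0 mn; have : x *+ m.+1 <= x *+ n by apply: oag_lerMn => //; exact: ltW.
by rewrite mulrS => ?; oag R_oag.
Qed.

Lemma ladder_succ d T x z : ladder d T -> T x -> T z -> x < z -> succ_in T x (x + d).
Proof.
move=> lT Tx Tz xz.
have [y xy] := succ_exists R_oag R_complete R_burden R_pos
  (ladder_dset lT) (ladder_discrete lT) Tz xz.
by have yE := ladder_gap lT Tx xy; rewrite yE in xy.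
Qed.

Lemma ladder_step d T x z : ladder d T -> T x -> T z -> x < z -> T (x + d).
Proof. by move=> lT Tx Tz xz; case: (ladder_succ lT Tx Tz xz). Qed.

Lemma ladder_separated d T : ladder d T -> separated d T.
Proof. by move=> lT x y Tx Ty xy; have [_ _ H] := ladder_succ lT Tx Ty xy; exact: H. Qed.

(** The strengthened claim shows that only finitely many elements lie up to [d *+ i]; as [T] is
    infinite, another one follows. *)
Lemma ladder_mulrn d T i : ladder d T -> T (d *+ i).
Proof.
move=> lT; suff : T (d *+ i) /\ forall x, T x -> x <= d *+ i -> exists2 j, (j <= i)%N & x = d *+ j.
  by case.
elim: i => [|i [Ti IH]].
  split; first exact: ladder0 lT.
  by move=> x Tx; exists 0%N => //; have := ladder_ge0 lT Tx => ?; rewrite !mulr0n in H *; oag R_oag.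
have [z Tz iz] : exists2 z, T z & d *+ i < z.
  apply: contrapT => nz; apply: (ladder_infinite lT).
  apply: (@sub_finite_set _ _ [set` [seq d *+ j | j <- iota 0 i.+1]]); last exact: finite_seq.
  move=> x Tx; have [|j ji ->] := IH x Tx.
    by rewrite (oag_leNgt R_oag); apply/negP => ix; apply: nz; exists x.
  by apply: (@map_f _ _ (fun j => d *+ j)); rewrite mem_iota.
have [TS _ HS] := ladder_succ lT Ti Tz iz.
rewrite mulrSr; split=> // x Tx xi.
have [xle|] := boolP (x <= d *+ i).
  by have [j ji ->] := IH x Tx xle; exists j => //; exact: leqW.
rewrite -(oag_ltNge R_oag) => ix; exists i.+1 => //.
by have := HS _ Tx ix => ?; rewrite mulrSr; oag R_oag.
Qed.

(** Neither set accumulates at any point of [R], so neither spoils the isolation of the other's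
    points. *)
Lemma discrete_union X Y : dset I X -> dset I Y -> discrete_subset X ->
  discrete_subset Y -> discrete_subset (fun x => X x \/ Y x).
Proof.
move=> dX dY disX disY x _.
have [a a0 Ha] := no_right_accumulation R_oag R_burden R_pos x dX disX.
have [b b0 Hb] := no_right_accumulation R_oag R_burden R_pos x dY disY.
have [a' a'0 Ha'] := no_left_accumulation R_oag R_burden R_pos x dX disX.
have [b' b'0 Hb'] := no_left_accumulation R_oag R_burden R_pos x dY disY.
have [e [e0 [ea eb]]] : exists e, 0 < e /\ e <= a /\ e <= b.
  by have [?|?] := orP (oag_le_total R_oag a b); [exists a|exists b].
have [f [f0 [fa fb]]] : exists f, 0 < f /\ f <= a' /\ f <= b'.
  by have [?|?] := orP (oag_le_total R_oag a' b'); [exists a'|exists b'].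
exists (x - f), (x + e); split; [oag R_oag..|] => y [Xy|Yy] ? ?.
- have [//|lt|lt] := oag_lt_total R_oag y x.
    by have := Ha' _ Xy lt => ?; exfalso; oag R_oag.
  by have := Ha _ Xy lt => ?; exfalso; oag R_oag.
- have [//|lt|lt] := oag_lt_total R_oag y x.
    by have := Hb' _ Yy lt => ?; exfalso; oag R_oag.
  by have := Hb _ Yy lt => ?; exfalso; oag R_oag.
Qed.

Lemma ladder_commensurable_le d1 d2 T1 T2 : ladder d1 T1 -> ladder d2 T2 ->
  d2 <= d1 -> exists k l, [/\ (0 < k)%N, (0 < l)%N & d1 *+ k = d2 *+ l].
Proof.
move=> l1 l2 d21; apply: contrapT => ncom.
have ncomP i j : (0 < i)%N -> (0 < j)%N -> d1 *+ i <> d2 *+ j.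
  by move=> i0 j0 e; apply: ncom; exists i, j.
have d10 := ladder_pos l1; have d20 := ladder_pos l2.
have dT1 := ladder_dset l1; have dT2 := ladder_dset l2.
(* Otherwise every standard multiple of [d2] stays within [d1], and part of [T2] fits inside the
   gaps of [T1]. *)
have [n nP] : exists n, d1 < d2 *+ n.
  apply: contrapT => /forallNP far.
  apply: (@nested_separated _ _ I R_oag R_burden (fun x e => T1 x)
    (fun x e => T2 x /\ x + d2 <= d1)).
  - by rewrite /defpar; rewrite /dset in dT1; drel.
  - by rewrite /defpar; rewrite /dset in dT2; drel.
  move=> n; exists (fun=> 0), d1, d2, (fun i => d1 *+ i), (fun i => d2 *+ i); split=> //.
  - exact: ladder_separated.
  - by move=> x y [Tx _] [Ty _]; exact: (ladder_separated l2 Tx Ty).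
  - by move=> y [Ty ?]; split=> //; exact: (ladder_ge0 l2 Ty).
  split=> [i _|i j /andP[ij _]].
    split; first exact: ladder_mulrn.
    split; first exact: ladder_mulrn.
    by have := far i.+1; rewrite mulrSr => /negP; rewrite -(oag_leNgt R_oag).
  have ? := oag_ltrMn d10 ij; have ? := oag_ltrMn d20 ij.
  by split=> ?; oag R_oag.
have /choice[j jP] : forall i, exists j, d2 *+ j <= d1 *+ i /\ d1 *+ i < d2 *+ j.+1.
  move=> i; have ex : exists m, d1 *+ i < d2 *+ m.
    elim: i => [|i [m im]]; first by exists 1%N.
    by exists (m + n)%N; rewrite mulrSr mulrnDr; oag R_oag.
  case: (ex_minnP ex) => -[|m] im m_min.
    have := oag_mulrn_ge0 R_oag i (ltW d10); rewrite mulr0n in im => ?.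
    by exfalso; oag R_oag.
  exists m; split=> //; rewrite (oag_leNgt R_oag); apply/negP => /m_min.
  by rewrite ltnn.
pose U x := T1 x \/ T2 x.
have dU : dset I U by rewrite /dset in dT1 dT2 *; rewrite /U; drel.
have disU : discrete_subset U.
  exact: discrete_union dT1 dT2 (ladder_discrete l1) (ladder_discrete l2).
have Ufin := gaps_finite R_oag R_complete R_burden R_pos dU disU.
(* The gap of the union ending at [d1 *+ i.+1]: its left end is the last multiple of [d2] before,
   since [d2 <= d1]. Two equal such gaps would give a common multiple. *)
pose h i := d1 *+ i.+1 - d2 *+ j i.+1.
have hU i : gaps U (h i).
  have [j1 j2] := jP i.+1; rewrite (mulrSr d2) in j2.
  have lt : d2 *+ j i.+1 < d1 *+ i.+1.
    move: j1; rewrite le_eqVlt => /predU1P[e|//]; exfalso.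
    have [j0|jpos] := posnP (j i.+1); last exact: (ncomP i.+1 _ isT jpos (esym e)).
    have := oag_mulrn_gt0 R_oag d10 (ltn0Sn i); rewrite -e j0 mulr0n => ?.
    by oag R_oag.
  exists (d2 *+ j i.+1), (d1 *+ i.+1); split=> //; first by right; exact: ladder_mulrn.
  split=> //; first by left; exact: ladder_mulrn.
  move=> c [Tc|Tc] xc; rewrite (oag_leNgt R_oag); apply/negP => cy.
    have := ladder_separated l1 Tc (ladder_mulrn i.+1 l1) cy => ?; oag R_oag.
  have := ladder_separated l2 (ladder_mulrn (j i.+1) l2) Tc xc => ?; oag R_oag.
have h_lt a b : (a < b)%N -> h a <> h b.
  rewrite /h -ltnS => ab e.
  have e1 : d1 *+ b.+1 = d1 *+ a.+1 + d1 *+ (b.+1 - a.+1).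
    by rewrite -mulrnDr subnKC// ltnW.
  have pos1 : 0 < d1 *+ (b.+1 - a.+1) by apply: oag_mulrn_gt0 => //; rewrite subn_gt0.
  have jab : (j a.+1 < j b.+1)%N.
    rewrite ltnNge; apply/negP => ba.
    by have := oag_lerMn R_oag (ltW d20) ba => ?; oag R_oag.
  have e2 : d2 *+ j b.+1 = d2 *+ j a.+1 + d2 *+ (j b.+1 - j a.+1).
    by rewrite -mulrnDr subnKC// ltnW.
  have e3 : d1 *+ (b.+1 - a.+1) = d2 *+ (j b.+1 - j a.+1).
    by clear - R_oag e e1 e2; oag R_oag.
  by apply: ncomP e3; rewrite subn_gt0.
apply: infinite_nat; rewrite (_ : setT = h @^-1` (gaps U)); last first.
  by apply/seteqP; split=> i // _; exact: hU.
apply: finite_preimage Ufin => a b _ _ e.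
by have [/h_lt|/h_lt|//] := ltngtP a b; rewrite e.
Qed.

Lemma ladder_commensurable d1 d2 T1 T2 : ladder d1 T1 -> ladder d2 T2 ->
  exists k l, [/\ (0 < k)%N, (0 < l)%N & d1 *+ k = d2 *+ l].
Proof.
move=> l1 l2; have [le|le] := orP (oag_le_total R_oag d1 d2); last exact: (ladder_commensurable_le l1 l2 le).
have [k [l [k0 l0 e]]] := ladder_commensurable_le l2 l1 le.
by exists l, k.
Qed.

Lemma dset_unary T : dset (unary_interpretation T) T.
Proof.
exists (@Rel (og_language unary_language) (Some tt) (fun _ => Var _ 0)), inl => e.
by rewrite /read.
Qed.

(** With [d1 *+ l = d2 *+ k], the elements of [T1] are the [y *+ k + d1 *+ j] for
    [y] in [T2] and [j < l], as far as [T1] reaches. *)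
Lemma ladder_definable d1 d2 T1 T2 : ladder d1 T1 -> ladder d2 T2 ->
  (forall x, T1 x -> exists2 y, T2 y & x <= y) -> dset (unary_interpretation T2) T1.
Proof.
move=> l1 l2 cof.
have [l [k [l0 k0 lk]]] := ladder_commensurable l1 l2.
have d10 := ladder_pos l1; have d20 := ladder_pos l2.
have dT1 := ladder_dset l1; have dT2 := ladder_dset l2.
(* The bounded existential over [j] is written as a negated bounded universal, the form that [drel]
   handles. *)
pose S x := exists y, T2 y /\ ~ (forall j, (j < l)%N -> ~ x = y *+ k + d1 *+ j).
have SI y j : T2 y -> (j < l)%N -> S (y *+ k + d1 *+ j).
  by move=> Ty jl; exists y; split=> // /(_ j jl).
have SE x : S x -> exists y j, [/\ T2 y, (j < l)%N & x = y *+ k + d1 *+ j].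
  move=> [y [Ty /existsNP[j /not_implyP[jl /contrapT ->]]]].
  by exists y, j.
have le_mulk (y : R) : 0 <= y -> y <= y *+ k.
  by move=> y0; have := oag_lerMn R_oag y0 k0; rewrite mulr1n.
(* Induction along [T1]: each step raises [j], and when [j] reaches [l] it returns to 0 while [y]
   moves to [y + d2]. *)
have T1S : forall x, T1 x -> 0 <= x -> S x.
  apply: (discrete_ind R_oag R_complete R_burden R_pos dT1 (ladder_discrete l1)).
  - by rewrite /dset in dT2 *; rewrite /S; drel.
  - exact: ladder0 l1.
  - by have := SI 0 0%N (ladder0 l2) l0; rewrite mul0rn addr0.
  move=> x x' Tx x0 xx' /SE[y [j [Ty jl xE]]].
  have -> : x' = x + d1 by exact: (ladder_gap l1 Tx xx').
  have [Tx' lxx' _] := xx'.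
  have [jl'|jl'] := boolP (j.+1 < l)%N.
    by have := SI _ _ Ty jl'; rewrite mulrSr addrA -xE.
  have ljE : l = j.+1 by apply/eqP; rewrite eqn_leq jl leqNgt jl'.
  have -> : x + d1 = (y + d2) *+ k + d1 *+ 0.
    by rewrite mulrnDl -lk ljE xE mulrSr mulr0n; oag R_oag.
  (* Cofinality gives [z] in [T2] above [y], so [T2] does not stop at [y]. *)
  apply: SI => //; have [z Tz xz] := cof _ Tx'.
  apply: (ladder_step l2 Ty Tz); have := le_mulk _ (ladder_ge0 l2 Ty) => ?.
  have := oag_mulrn_ge0 R_oag j (ltW d10) => ?; oag R_oag.
have T1_add w z j : T1 w -> T1 z -> w + d1 *+ j <= z -> T1 (w + d1 *+ j).
  move=> Tw Tz; elim: j => [|j IH]; first by rewrite addr0.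
  rewrite mulrSr addrA => le; apply: (ladder_step l1 _ Tz); last by oag R_oag.
  by apply: IH; oag R_oag.
(* Here [z] witnesses that [T1] reaches as far as [y *+ k]. *)
have T2T1 : forall y, T2 y -> 0 <= y -> forall z, T1 z -> y *+ k <= z -> T1 (y *+ k).
  apply: (discrete_ind R_oag R_complete R_burden R_pos dT2 (ladder_discrete l2)
    (P := fun y => forall z, T1 z -> y *+ k <= z -> T1 (y *+ k))).
  - by rewrite /dset in dT1 *; drel.
  - exact: ladder0 l2.
  - by move=> z _ _; rewrite mul0rn; exact: ladder0 l1.
  move=> y y' Ty y0 yy' IH z Tz.
  have -> : y' = y + d2 by exact: (ladder_gap l2 Ty yy').
  rewrite mulrnDl -lk => le; apply: (T1_add _ z) => //; apply: (IH z Tz).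
  by have := oag_mulrn_ge0 R_oag l (ltW d10) => ?; oag R_oag.
have ST1 x z : S x -> T1 z -> x <= z -> T1 x.
  move=> /SE[y [j [Ty _ ->]]] Tz le.
  apply: (T1_add _ z) => //; apply: (T2T1 _ Ty _ z Tz); first exact: (ladder_ge0 l2 Ty).
  by have := oag_mulrn_ge0 R_oag j (ltW d10) => ?; oag R_oag.
have dS : dset (unary_interpretation T2) S.
  have := @dset_unary T2; rewrite /dset /S => dT; drel.
(* [S] may run beyond a bounded [T1], in which case it is cut at the maximum of [T1]. *)
have [[b Hb]|nb] := pselect (exists b, forall x, T1 x -> x <= b).
  have [||m [Tm Hm]] := dset_has_max R_oag R_complete R_burden R_pos dT1 (ladder_discrete l1).
  - by exists 0; exact: ladder0 l1.
  - by exists b.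
  rewrite (_ : T1 = (fun x => S x /\ x <= m)); first by rewrite /dset in dS *; drel.
  apply/seteqP; split=> x; last by case=> Sx; exact: ST1.
  by move=> Tx; split; [apply: T1S => //; exact: (ladder_ge0 l1 Tx)|exact: Hm].
rewrite (_ : T1 = S)//; apply/seteqP; split=> x.
  by move=> Tx; apply: T1S => //; exact: (ladder_ge0 l1 Tx).
move=> Sx; apply: contrapT => nTx; apply: nb; exists x => y Ty.
rewrite (oag_leNgt R_oag); apply/negP => xy; apply: nTx; apply: (ST1 x y) => //.
exact: ltW.
Qed.

End Ladders.

(** Formulas are translated symbol by symbol, the predicate being replaced by a definition of
    [T]. *)
Lemma dset_trans (R : porderZmodType) (L : language) (I : interpretation L R)
    (T X : set R) :
  dset I T -> dset (unary_interpretation T) X -> dset I X.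
Proof.
move=> dT [p [s ps]].
have dfun_eval t : @deffun _ (og_expansion I)
    (fun e => @eval _ (og_expansion (unary_interpretation T)) e t).
  elim: t => [i|[[]|] ts IH] /=; first by exact: deffun_var.
  by apply: (@deffun_add _ _ I); exact: IH.
have drel_sat q : @defrel _ (og_expansion I)
    (fun e => @sat _ (og_expansion (unary_interpretation T)) e q).
  elim: q => [|t u|[[]|] ts|q IHq r IHr|q IHq] /=.
  - exact: defrel_cst.
  - by apply: (@defrel_eq _ (og_expansion I)); exact: dfun_eval.
  - by apply: (@defrel_app _ (og_expansion I) T) => //; exact: dfun_eval.
  - by apply: (@defrel_lt _ _ I); exact: dfun_eval.
  - exact: defrel_imp.
  - apply: (@defrel_all _ (og_expansion I)
      (fun x e => @sat _ (og_expansion (unary_interpretation T)) (scons x e) q)).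
    apply: defrel_ext IHq => e.
    by rewrite (_ : scons _ _ = e)//; apply: funext => -[].
have := @defrel_read _ (og_expansion I) _ s (drel_sat p).
by apply: defrel_ext => e; exact: iff_sym (ps e).
Qed.

(** * Sets definable from a ladder *)

Section Definability.
Variables (R : porderZmodType) (L : language) (I : interpretation L R).
Hypothesis R_oag : divisible_oag R.
Local Notation M := (og_expansion I).
Hypothesis R_complete : definably_complete I.
Hypothesis R_burden : burden_le M 2.
Hypothesis R_pos : exists u : R, 0 < u.
Implicit Types (d : R) (C D T X : set R).

(** Finite sets are a separate case, since they do not provide a ladder. *)
Definition ladder_def X : Prop :=
  finite_set X \/ exists d T, ladder I d T /\ dset (unary_interpretation T) X.

Lemma dset_finite (L' : language) (J : interpretation L' R) X :
  finite_set X -> dset J X.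
Proof.
move=> /finite_seqP[s ->]; rewrite /dset; elim: s => [|y s IH].
  by apply: (@defrel_ext _ (og_expansion J) (fun=> False)); [|exact: defrel_cst].
apply: (@defrel_ext _ (og_expansion J) (fun e => e 0%N = y \/ [set` s] (e 0%N))).
  move=> e /=; rewrite inE; split=> [[->|->]|/predU1P[->|?]]; rewrite ?eqxx ?orbT//.
    by left.
  by right.
by drel.
Qed.

Lemma ladder_def_sub d T X d' T' : ladder I d T -> ladder I d' T' ->
  (forall x, T x -> exists2 y, T' y & x <= y) ->
  dset (unary_interpretation T) X -> dset (unary_interpretation T') X.
Proof.
move=> lT lT' cof; apply: dset_trans.
exact: (ladder_definable R_oag R_complete R_burden R_pos lT lT' cof).
Qed.

(** Of two ladders, one is cofinal with respect to the other and defines it, so a single ladder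
    serves both sets. *)
Lemma ladder_def_union X Y : ladder_def X -> ladder_def Y ->
  ladder_def (fun x => X x \/ Y x).
Proof.
have dU (L' : language) (J : interpretation L' R) A B : dset J A -> dset J B ->
    dset J (fun x => A x \/ B x).
  by rewrite /dset => dA dB; drel.
move=> [finX|[d [T [lT dX]]]] [finY|[d' [T' [lT' dY]]]].
- by left; rewrite (_ : (fun x => _) = X `|` Y)// finite_setU.
- by right; exists d', T'; split=> //; apply: dU => //; exact: dset_finite.
- by right; exists d, T; split=> //; apply: dU => //; exact: dset_finite.
- right; have [cof|ncof] := pselect (forall x, T x -> exists2 y, T' y & x <= y).
    by exists d', T'; split=> //; apply: dU => //; exact: (ladder_def_sub lT lT' cof dX).
  exists d, T; split=> //; apply: dU => //; apply: (ladder_def_sub lT' lT _ dY).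
  move/existsNP: ncof => [x /not_implyP[Tx nx]] y T'y; exists x => //.
  by rewrite (oag_leNgt R_oag); apply/negP => xy; apply: nx; exists y => //; exact: ltW.
Qed.

Lemma ladder_def_opp X : ladder_def X -> ladder_def (fun x => X (- x)).
Proof.
move=> [finX|[d [T [lT dX]]]]; last first.
  by right; exists d, T; split=> //; exact: (defrel_opp dX).
left; apply: sub_finite_set (finite_image (fun x : R => - x) finX).
by move=> x Xx; exists (- x) => //; rewrite opprK.
Qed.

(** An infinite such [C] becomes a ladder after translation of its minimum to [0]. *)
Lemma ladder_def_single_gap C d : dset I C -> discrete_subset C ->
  (exists b, forall x, C x -> b <= x) -> 0 < d -> single_gap d C -> ladder_def C.
Proof.
move=> dC disC Cb d0 gapC.
have [finC|infC] := pselect (finite_set C); [by left|right].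
have [x Cx] := infinite_setN0 infC.
have [||m [Cm Hm]] := dset_has_min R_oag R_complete R_burden R_pos dC disC => //.
  by exists x.
pose T x := C (x + m); exists d, T; split; last first.
  have dT := @dset_unary R T; rewrite /dset in dT *.
  apply: (@defrel_ext _ (og_expansion (unary_interpretation T))
    (fun e => T ((e 0%N : R) - m))); first by move=> e; rewrite /T subrK.
  by drel.
split=> //.
- by rewrite /dset /T in dC *; drel.
- move=> y /disC[u [v [uy yv H]]]; exists (u - m), (v - m); split; [oag R_oag..|].
  move=> z Tz uz zv; apply: (addIr m); apply: H => //; oag R_oag.
- move=> y z Ty [Tz yz H].
  have : z + m = (y + m) + d.
    apply: gapC => //; split=> //; first by oag R_oag.
    move=> c Cc yc; have : z <= c - m.
      by apply: H; [rewrite /T subrK|oag R_oag].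
    by move=> ?; oag R_oag.
  by move=> ?; oag R_oag.
- by rewrite /T add0r.
- by move=> y /Hm ?; oag R_oag.
- move=> finT; apply: infC; apply: sub_finite_set (finite_image (fun y => y + m) finT).
  by move=> y Cy; exists (y - m); rewrite /T subrK.
Qed.

Lemma ladder_def_above D a : dset I D -> discrete_subset D -> D a ->
  ladder_def (fun x => D x /\ a <= x).
Proof.
move=> dD disD Da.
apply: (above_cover R_oag R_complete R_burden R_pos dD disD (Q := ladder_def)) => //.
- by left; exact: finite_set0.
- exact: ladder_def_union.
move=> C d dC CD Cb d0 gapC.
by apply: ladder_def_single_gap gapC => //; exact: discrete_sub disD.
Qed.

(** The covering argument runs upwards from a point, so [D] is split at [a] and its lower part is
    reflected. *)
Lemma discrete_ladder_def D : dset I D -> discrete_subset D -> ladder_def D.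
Proof.
move=> dD disD; have [[a Da]|noD] := pselect (exists a, D a); last first.
  left; rewrite (_ : D = set0); first exact: finite_set0.
  by apply/seteqP; split=> // x Dx; case: noD; exists x.
have up := ladder_def_above dD disD Da.
have Da' : D (- - a) by rewrite opprK.
have down := ladder_def_opp (ladder_def_above (defrel_opp dD) (discrete_opp R_oag disD) Da').
have := ladder_def_union up down.
rewrite (_ : (fun x => _ \/ _) = D)//; apply/seteqP; split=> x.
  by move=> [[]|[+ _]]; rewrite ?opprK.
move=> Dx; have [ax|xa] := orP (oag_le_total R_oag a x); [by left|right].
by rewrite opprK; split=> //; oag R_oag.
Qed.

Lemma ladder_pseudo_arithmetic d T : ladder I d T -> pseudo_arithmetic T.
Proof.
move=> lT; split; first exact: (ladder_discrete lT).
- move=> a [Ta [b Tb ab]]; exists (a + d).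
  exact: (ladder_succ R_oag R_complete R_burden R_pos lT Ta Tb ab).
exists d; apply/seteqP; split=> x.
  move=> [a [b [[Ta _] ab ->]]]; rewrite (ladder_gap lT Ta ab) /=.
  by rewrite addrC addKr.
move=> ->; have T0 := ladder0 lT; have d0 := ladder_pos lT.
have Td : T d.
  by have := ladder_mulrn R_oag R_complete R_burden R_pos 1 lT; rewrite mulr1n.
exists 0, d; split; last by rewrite subr0.
- by split=> //; exists d.
- by have := ladder_succ R_oag R_complete R_burden R_pos lT T0 Td d0; rewrite add0r.
Qed.

End Definability.

Theorem theorem3p43 (R : porderZmodType) (L : language) (I : interpretation L R)
    (R_oag : divisible_oag R)
    (R_complete : definably_complete I)
    (R_burden : burden_eq (og_expansion I) 2)
    (D : set R)
    (D_definable : @definable _ (og_expansion I) D)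
    (D_infinite : infinite_set D)
    (D_discrete : discrete_subset D) :
  exists E : set R,
    [/\ @definable _ (og_expansion I) E,
        pseudo_arithmetic E
      & @definable _ (og_expansion (unary_interpretation E)) D].
Proof.
have [R_burden2 _] := R_burden.
have R_pos : exists u : R, 0 < u.
  have [f [_ /(_ 0%N 1%N isT) f01]] := infinite_increasing R_oag 2 D_infinite.
  by exists (f 1%N - f 0%N); oag R_oag.
have dD : dset I D by exact: (@defrel_of_definable _ (og_expansion I) D).
(* The finite alternative contradicts [D_infinite]. *)
have [//|[d [T [lT dT]]]] :=
  discrete_ladder_def R_oag R_complete R_burden2 R_pos dD D_discrete.
exists T; split.
- exact: (@definable_of_defrel _ (og_expansion I) (0 : R) T (ladder_dset lT)).
- exact: ladder_pseudo_arithmetic lT.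
- exact: (@definable_of_defrel _ (og_expansion (unary_interpretation T)) (0 : R) D dT).
Qed.
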